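(* Consider the interacting particle system $\mathrm{IPS}(P)$ on $\Lambda=\mathbb{Z}$ with neighbourhoods $\mathcal{N}_j=\{j,j+1\}$, alphabet $\mathcal{A}=\{0,1\}$ and homogeneous transition matrix $P$ with positive rates, i.e. $$P(1\,|\,11)<1,\quad P(1\,|\,10)<1,\quad P(1\,|\,01)>0,\quad P(1\,|\,00)>0,$$ and assume $P(1\,|\,10)=P(1\,|\,01)$. Then $\mathrm{IPS}(P)$ is uniformly exponentially ergodic.
   Context: $P(1\,|\,uv)$ denotes the probability that an updated site $j$ takes the value $1$ when, immediately before the update, the state at $j$ is $u$ and the state at $j+1$ is $v$; homogeneous means this does not depend on $j$. $\mathrm{IPS}(P)$: every site of $\mathbb{Z}$ has an independent rate-$1$ exponential clock; whenever the clock at $j$ rings at time $\tau$, the state at $j$ is resampled from $P(\cdot\,|\,\zeta_{\tau^-}(j)\zeta_{\tau^-}(j+1))$ (left limits) independently of everything else, and states do not change otherwise. For a distribution $\nu$ on $\{0,1\}^{\mathbb{Z}}$, $\nu P_t$ is the law of $\zeta_t$ when $\zeta_0\sim\nu$. A distribution $\mu$ is invariant if $\mu P_t=\mu$ for all $t\ge0$, and attractive if $\nu P_t\Rightarrow\mu$ in distribution as $t\to\infty$ for every $\nu$. The IPS is (uniformly) exponentially ergodic if it has an attractive invariant measure $\mu$ and there is $\alpha>0$ such that for every finite $S\subseteq\mathbb{Z}$ there is a constant $C_S\ge0$ with $\sup_\nu|\nu P_t(A)-\mu(A)|\le C_Se^{-\alpha t}$ for every $t\ge 0$ and every cylinder set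 $A$ with support $S$, the supremum being over all initial distributions $\nu$. *)

(* Defs.v *)
From HB Require Import structures.
From mathcomp Require Import all_boot all_order all_algebra.
From mathcomp Require Import all_classical all_reals all_analysis.

Set Implicit Arguments.
Unset Strict Implicit.
Unset Printing Implicit Defensive.

Import Order.TTheory GRing.Theory Num.Theory.
Import numFieldNormedType.Exports.

Local Open Scope classical_set_scope.
Local Open Scope ring_scope.

(* {0,1}^Z with the product sigma-algebra; [true] is the letter 1. *)
Definition coordinate_sets : set (set (int -> bool)) :=
  [set A | exists (j : int) (a : bool), A = [set x | x j = a]].

Notation config := (g_sigma_algebraType coordinate_sets).

Section interacting_particle_system.
Context {R : realType}.

(* [P a u v] is P(a | uv). *)
Definition transition_matrix (P : bool -> bool -> bool -> R) : Prop :=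
  forall u v, [/\ 0 <= P false u v, 0 <= P true u v
                & P false u v + P true u v = 1].

Definition mutually_independent {d} {Omega : measurableType d}
    (Pr : probability Omega R) {I : eqType} (F : I -> set (set Omega)) : Prop :=
  forall (s : seq I) (E : I -> set Omega), uniq s ->
    (forall i, i \in s -> F i (E i)) ->
    Pr (\big[setI/setT]_(i <- s) E i) = (\prod_(i <- s) Pr (E i))%E.

Definition generated_events {d d'} {Omega : measurableType d}
    {T : measurableType d'} (X : Omega -> T) : set (set Omega) :=
  preimage_set_system setT X measurable.

(* Time of the [n]-th ring (from [n = 0]) of the clock at [j], given the
   waiting times between successive rings. *)
Definition ring_time {Omega : Type} (W : int -> nat -> Omega -> R)
    (j : int) (n : nat) (w : Omega) : R :=
  \sum_(k < n.+1) W j k w.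

(* [zeta] is IPS(P) on (Omega, Pr): the clock at [j] has i.i.d. Exp(1) waiting
   times [W j n], and at its [n]-th ring the new letter at [j] is sampled from
   P(. | uv) by means of a fresh uniform variable [U j n], which falls below
   P(1 | uv) with probability P(1 | uv). The initial state and all the [W j n],
   [U j n] are independent. *)
Record is_IPS (P : bool -> bool -> bool -> R) {d} {Omega : measurableType d}
    (Pr : probability Omega R) (W U : int -> nat -> {RV Pr >-> R})
    (zeta : R -> Omega -> config) : Prop := {
  IPS_measurable : forall t : R, 0 <= t -> measurable_fun setT (zeta t) ;
  IPS_waiting_time : forall j n (B : set R), measurable B ->
    distribution Pr (W j n) B = exponential_prob 1 B ;
  IPS_uniform : forall j n (B : set R), measurable B ->
    distribution Pr (U j n) B = uniform_prob (@ltr01 R) B ;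
  IPS_independent : mutually_independent Pr
    (fun i : unit + int * nat + int * nat =>
       match i with
       | inl (inl _) => generated_events (zeta 0)
       | inl (inr (j, n)) => generated_events (W j n)
       | inr (j, n) => generated_events (U j n)
       end) ;
  IPS_update : {ae Pr, forall w, forall j n,
    exists u v : bool,
      [/\ zeta s w j @[s --> (ring_time W j n w)^'-] --> u,
          zeta s w (j + 1) @[s --> (ring_time W j n w)^'-] --> v
        & zeta (ring_time W j n w) w j = (U j n w < P true u v)]} ;
  IPS_constant : {ae Pr, forall w, forall (j : int) (s t : R), 0 <= s -> s <= t ->
    (forall n, ~ (s < ring_time W j n w <= t)) ->
    zeta t w j = zeta s w j}
}.

(* [Pt nu t] is nu P_t. Measures are compared on measurable sets only: a
   [probability] also takes (meaningless) values on the other sets. *)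
Definition IPS_semigroup (P : bool -> bool -> bool -> R)
    (Pt : probability config R -> R -> probability config R) : Prop :=
  forall nu : probability config R,
    exists (d : measure_display) (Omega : measurableType d)
           (Pr : probability Omega R) (W U : int -> nat -> {RV Pr >-> R})
           (zeta : R -> Omega -> config),
      [/\ is_IPS P W U zeta,
          forall A, measurable A -> Pr (zeta 0 @^-1` A) = nu A
        & forall (t : R) (A : set config), 0 <= t -> measurable A ->
            Pt nu t A = Pr (zeta t @^-1` A)].

Definition converges_in_distribution (mu_ : R -> probability config R)
    (mu : probability config R) : Prop :=
  forall f : {ptws int -> bool} -> R, continuous f ->
    (exists M : R, forall x, `|f x| <= M) ->
    (\int[mu_ t]_(x in [set: config]) (f x)%:E)%E @[t --> +oo] -->
      (\int[mu]_(x in [set: config]) (f x)%:E)%E.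

Definition invariant_distribution
    (Pt : probability config R -> R -> probability config R)
    (mu : probability config R) : Prop :=
  forall t : R, 0 <= t -> forall A, measurable A -> Pt mu t A = mu A.

Definition attractive_distribution
    (Pt : probability config R -> R -> probability config R)
    (mu : probability config R) : Prop :=
  forall nu, converges_in_distribution (Pt nu) mu.

Definition cylinder_with_support (S : set int) (A : set config) : Prop :=
  forall x y : config, (forall j, S j -> x j = y j) -> A x -> A y.

Definition uniformly_exponentially_ergodic
    (Pt : probability config R -> R -> probability config R) : Prop :=
  exists mu : probability config R,
    [/\ invariant_distribution Pt mu, attractive_distribution Pt mu
      & exists2 alpha : R, 0 < alpha &
        forall S : set int, finite_set S ->
          exists2 C : R, 0 <= C &
            forall (t : R) (A : set config), 0 <= t -> cylinder_with_support S A ->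
              (ereal_sup [set `|Pt nu t A - mu A| | nu in setT]
                 <= (C * expR (- (alpha * t)))%:E)%E].

End interacting_particle_system.

(* Main.v *)
Require Import Defs.
From mathcomp Require Import all_boot all_order all_algebra finmap.
From mathcomp Require Import all_classical all_reals all_analysis.
From mathcomp Require Import measurable_realfun.
From mathcomp Require Import ring lra.
From HB Require Import structures.

(** Write [a = P(1|00)], [b = P(1|01) = P(1|10)], [c = P(1|11)], and for a real
number [m] let [y_j = x_j - m] and [h_S = \prod_(j in S) y_j] for every finite
set [S] of sites. The functions [h_S] span the functions of finitely many
sites. When [j] is resampled, the expectation of the new [y_j] is
  [bias + slope * (y_j + y_(j+1)) + quad * y_j * y_(j+1)];
the two linear coefficients agree because [P(1|01) = P(1|10)]. Since [y_j ^ 2]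
is an affine function of [y_j], the generator maps [h_S] to a finite
combination of the [h_T], so the moments [E h_S(zeta_t)] solve a closed linear
system of equations.

Give [h_S] the weight [w ^ #|S|], with [w = max(m, 1 - m)] the largest
possible value of [|y_j|]. In these weights the system, restricted to nonempty
[S], is strictly diagonally dominant as soon as
  [slope + |slope| + |quad| * w + |bias| / w < 1]
([site_drift_bound]). Positive rates provide a suitable [m]: one may take
[1/2], or [0], or the critical point of the mean-field map, up to exchanging
the two letters ([contracting_parameters]). A Gronwall argument then shows
that the difference of two solutions, which vanishes at the empty set, decays
exponentially in the weighted supremum norm ([moment_decay]).

Time shifts of solutions are solutions. Comparing the process at times [s + t]
and [s' + t], from any two initial laws, therefore gives a bound
[C * exp(- beta * t)] uniform in the initial laws and in [s], [s']. Hence the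
laws at time [t] form a Cauchy family on functions of finitely many sites.
Their limits are consistent, and the measure with these values is obtained as
the law of a binary expansion of a uniform variable ([limit_measure]). It is
invariant because the process started from it has, by the same comparison, the
same moments as the limit of the process run for a long time. Attractiveness
for arbitrary continuous functions follows by uniform approximation on the
compact space of configurations.

It remains to derive the linear system from the graphical definition of the
process ([moment_one_step]). During a time interval of length [h] after [t],
up to an event of probability [O(h ^ 2)], at most one clock near [S] rings,
and it rings once. The point is that this next ring at [j] and its update
variable are independent of the state at time [t]. When the clock at [j] has
rung exactly [n] times by [t], the state at [t] is almost surely a function of
the initial state and of all the waiting times and update variables other than
the [n]-th ones at [j] ([determined_state]): to the right of any site there
is a site whose clock is silent until [t], and from it the states can be
reconstructed leftwards. Independence and the lack of memory of the
exponential law ([memoryless]) then give the probabilities of the next ring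
([rings_prob], [update_below_prob]). *)

Set Implicit Arguments.
Unset Strict Implicit.
Unset Printing Implicit Defensive.

Import Order.TTheory GRing.Theory Num.Theory.
Import numFieldNormedType.Exports.
Local Open Scope classical_set_scope.
Local Open Scope ring_scope.

(** * Parameters for which the moment system is contracting *)

Section parameters.
Context {R : realFieldType}.
Implicit Types a b c m : R.

(** With [a], [b], [c] the probabilities of the letter 1 after 00, after 01 or
10, and after 11, and [u + v], [u * v] the sum and product of the two letters,
[P(1|uv) = a + (b - a) * (u + v) + quad * u * v]. Substituting [u = m + y] and
[v = m + z] gives
[P(1|uv) - m = bias + slope * (y + z) + quad * y * z]. *)
Definition quad a b c : R := c - 2 * b + a.
Definition slope a b c m : R := b - a + quad a b c * m.
Definition bias a b c m : R :=
  a + 2 * m * (b - a) + quad a b c * m ^+ 2 - m.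

Definition contracting a b c m w : Prop :=
  slope a b c m + `|slope a b c m| + `|quad a b c| * w
    + `|bias a b c m| / w < 1.

Lemma norm_cases (x : R) : (0 <= x /\ `|x| = x) \/ (x <= 0 /\ `|x| = - x).
Proof.
by have [h|h] := leP 0 x; [left|right]; split=> //;
  [exact: ger0_norm|exact: ltW|exact: ltr0_norm].
Qed.

(** For [m = 1/2] the left-hand side of the criterion is
[max (0, c - a) + max (|a + c - 1|, |2 * b - 1|)], and [c - a + |a + c - 1|] is
[max (2 * c - 1, 1 - 2 * a)], which is below [1] for positive rates. *)
Lemma contracting_half a b c : 0 < a -> a <= 1 -> 0 < b -> b < 1 ->
  0 <= c -> c < 1 -> (a < c -> c - a + `|2 * b - 1| < 1) ->
  contracting a b c (2^-1) (2^-1).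
Proof.
move=> a0 a1 b0 b1 c0 c1 h; rewrite /contracting invrK.
have -> : slope a b c 2^-1 = (c - a) / 2 by rewrite /slope /quad; field.
have -> : bias a b c 2^-1 = (a + 2 * b + c - 2) / 4 by rewrite /bias /quad; field.
rewrite /quad.
have [ac|ca] := ltP a c; [move: (h ac) | move: h => _];
case: (norm_cases ((c - a) / 2)) => -[? ->];
case: (norm_cases (c - 2 * b + a)) => -[? ->];
case: (norm_cases ((a + 2 * b + c - 2) / 4)) => -[? ->];
try (case: (norm_cases (2 * b - 1)) => -[? ->]); lra.
Qed.

(** Exchanging the two letters changes the signs of [bias] and [quad] only. *)
Lemma contracting_flip a b c m w : contracting a b c m w ->
  contracting (1 - c) (1 - b) (1 - a) (1 - m) w.
Proof.
rewrite /contracting.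
have -> : slope (1 - c) (1 - b) (1 - a) (1 - m) = slope a b c m.
  by rewrite /slope /quad; ring.
have -> : quad (1 - c) (1 - b) (1 - a) = - quad a b c by rewrite /quad; ring.
have -> : bias (1 - c) (1 - b) (1 - a) (1 - m) = - bias a b c m.
  by rewrite /bias /quad; ring.
by rewrite !normrN.
Qed.

(** [F(m) = bias + m] is the mean-field map. If [b] is not in the range covered
by [m = 1/2], then either [F] is increasing on [[0, 1]], and [m = 0] turns the
criterion into [F(1) = c < 1], or [F] has its minimum in [[0, 1/2]], and this
critical point kills the slope. *)
Lemma contracting_convex a b c : 0 < a -> a < c -> 0 < b -> b < 1 ->
  c < 1 -> 0 <= quad a b c ->
  exists2 m, 0 <= m <= 2^-1 & contracting a b c m (1 - m).
Proof.
move=> a0 ac b0 b1 c1 q0.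
have [bh|bh] := leP 2^-1 b.
  exists 2^-1; first lra.
  have -> : 1 - 2^-1 = 2^-1 :> R by field.
  apply: contracting_half => //; try lra.
  by move=> _; rewrite ger0_norm; rewrite /quad in q0; lra.
have [ch|ch] := ltP c (a + 2 * b).
  exists 2^-1; first lra.
  have -> : 1 - 2^-1 = 2^-1 :> R by field.
  apply: contracting_half => //; try lra.
  by move=> _; rewrite ler0_norm; lra.
have [ab|ba] := leP a b.
  exists 0; first lra.
  rewrite /contracting.
  have -> : slope a b c 0 = b - a by rewrite /slope; ring.
  have -> : bias a b c 0 = a by rewrite /bias; ring.
  rewrite subr0 divr1 !ger0_norm /quad; lra.
have q2 : 0 < quad a b c by rewrite /quad; lra.
have qn0 : quad a b c != 0 by rewrite gt_eqF.
exists ((a - b) / quad a b c).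
  apply/andP; split; first by rewrite divr_ge0//; lra.
  by rewrite ler_pdivrMr// /quad; lra.
set m := _ / _.
have qm : quad a b c * m = a - b by rewrite mulrC divfK.
have m_half : m <= 2^-1.
  by rewrite ler_pdivrMr// /quad; lra.
move: m qm m_half => m qm m_half; rewrite /contracting.
have -> : slope a b c m = 0 by rewrite /slope qm; ring.
rewrite normr0 !addr0 add0r ger0_norm//.
have -> : quad a b c * (1 - m) = c - b by rewrite mulrBr qm /quad; ring.
have -> : bias a b c m = a - (a - b) * m - m.
  rewrite /bias; have -> : quad a b c * m ^+ 2 = (a - b) * m.
    by rewrite -qm; ring.
  ring.
rewrite -subr_gt0 -(pmulr_lgt0 _ (_ : 0 < 1 - m)); last lra.
have -> : (1 - (c - b + `|a - (a - b) * m - m| / (1 - m))) * (1 - m)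
   = (1 - c + b) * (1 - m) - `|a - (a - b) * m - m|.
  by field; lra.
case: (norm_cases (a - (a - b) * m - m)) => -[? ->].
  suff: 0 < (1 - c) * (1 - m) + ((1 - m) * b - a + (a - b) * m + m).
    by lra.
  have e : (a - b) * (1 - m) <= (1 - b) * m.
    rewrite -(ler_pM2l q2).
    have -> : quad a b c * ((a - b) * (1 - m)) =
       (a - b) * (quad a b c - (quad a b c * m)) by ring.
    have -> : quad a b c * ((1 - b) * m) = (1 - b) * (quad a b c * m) by ring.
    by rewrite qm /quad; nra.
  have : 0 < (1 - c) * (1 - m) by apply: mulr_gt0; lra.
  by lra.
rewrite -(pmulr_lgt0 _ q2).
have -> : ((1 - c + b) * (1 - m) - - (a - (a - b) * m - m)) * quad a b c
  = (1 - c + b) * (quad a b c - (quad a b c * m)) + (a * quad a b c - (a - b) * (quad a b c * m) - quad a b c * m) by ring.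
rewrite qm /quad; nra.
Qed.

(** For [c <= a] the choice [m = 1/2] works; for [a < c] exchange the letters if
needed to make [F] convex. *)
Lemma contracting_parameters a b c : 0 < a -> a <= 1 -> 0 < b -> b < 1 ->
  0 <= c -> c < 1 ->
  exists2 m, 0 <= m <= 1 & contracting a b c m (Num.max m (1 - m)).
Proof.
move=> a0 a1 b0 b1 c0 c1.
have [ca|ac] := leP c a.
  exists 2^-1; first lra.
  have -> : 1 - 2^-1 = 2^-1 :> R by field.
  by rewrite maxxx; apply: contracting_half => //; rewrite ltNge ca.
have [q|q] := leP 0 (quad a b c).
  have [m mh cm] := contracting_convex a0 ac b0 b1 c1 q.
  by exists m; [lra | rewrite max_r//; lra].
have [||||||m mh cm] := @contracting_convex (1 - c) (1 - b) (1 - a); try lra.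
  by move: q; rewrite /quad; lra.
exists (1 - m); first lra.
rewrite max_l; last lra.
by have := contracting_flip cm; rewrite !subKr.
Qed.

End parameters.

(** * Exponential decay for the moment system *)

Section gronwall.
Context {R : realType}.

(** A forward Euler step multiplies the bound [A * exp(- bet * s)] by at most
[1 - h * D + h * (D - bet) = 1 - h * bet <= exp(- bet * h)]; the quadratic errors
of [n] steps of length [t / n] sum up to [C * t ^ 2 / n]. *)
Lemma discrete_gronwall (g : R -> R) (D A C bet T : R) :
  0 <= bet -> bet <= D -> 0 <= A -> 0 <= C -> `|g 0| <= A ->
  (forall s h, 0 <= s -> 0 <= h <= 1 -> h * D <= 1 -> s + h <= T ->
    `|g (s + h)| <= (1 - h * D) * `|g s| + h * (D - bet) * (A * expR (- (bet * s)))
                     + C * h ^+ 2) ->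
  forall t, 0 <= t <= T -> `|g t| <= A * expR (- (bet * t)).
Proof.
move=> bet0 betD A0 C0 g0 step t /andP[t0 tT].
apply/ler_addgt0Pr => e e0.
(* With [n > M] steps of length [t / n], each step is at most [1] and at most
   [1 / D], and the accumulated error [C * t ^ 2 / n] is below [e]. *)
pose M := `|t| + `|t * D| + C * t ^+ 2 / e.
have M0 : 0 <= M.
  by rewrite !addr_ge0// divr_ge0 ?mulr_ge0 ?sqr_ge0// ltW.
pose n := (Num.truncn M).+1.
have Mn : M < n%:R := truncnS_gt M.
have n0 : 0 < n%:R :> R by rewrite ltr0n.
pose h := t / n%:R.
have h0 : 0 <= h by rewrite divr_ge0// ltW.
have h1 : h <= 1.
  rewrite ler_pdivrMr// mul1r (le_trans _ (ltW Mn))// /M -addrA.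
  by rewrite (le_trans (ler_norm t))// lerDl addr_ge0// divr_ge0 ?mulr_ge0 ?sqr_ge0// ltW.
have hD : h * D <= 1.
  rewrite mulrAC ler_pdivrMr// mul1r (le_trans _ (ltW Mn))// /M addrAC.
  by rewrite (le_trans (ler_norm _))// lerDr addr_ge0// divr_ge0 ?mulr_ge0 ?sqr_ge0// ltW.
have hn : h * n%:R = t by rewrite divfK// gt_eqF.
have ind k : (k <= n)%N ->
    `|g (h * k%:R)| <= A * expR (- (bet * (h * k%:R))) + k%:R * (C * h ^+ 2).
  elim: k => [|k ih] kn; first by rewrite !(mulr0,oppr0,expR0,mul0r,addr0,mulr1).
  have := ih (ltnW kn); set E := expR _ => {}ih.
  have -> : h * k.+1%:R = h * k%:R + h by rewrite -natr1 mulrDr mulr1.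
  have le1 := step (h * k%:R) h; apply: le_trans (le1 _ _ _ _) _ => //.
  - by rewrite mulr_ge0.
  - by rewrite h0.
  - apply: le_trans tT; rewrite -[leRHS]hn -[X in _ + X]mulr1 -mulrDr.
    by rewrite ler_wpM2l// natr1 ler_nat.
  rewrite -/E.
  have -> : expR (- (bet * (h * k%:R + h))) = E * expR (- (bet * h)).
    by rewrite /E -expRD mulrDr opprD.
  have E0 : 0 <= E by rewrite expR_ge0.
  have e1 : 1 - bet * h <= expR (- (bet * h)) by rewrite expR_ge1Dx.
  have s1 : (1 - h * D) * `|g (h * k%:R)| <=
      (1 - h * D) * (A * E) + k%:R * (C * h ^+ 2).
    apply: le_trans (ler_wpM2l _ ih) _; first by rewrite subr_ge0.
    rewrite mulrDr lerD2l ler_piMl//.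
      by rewrite mulr_ge0// mulr_ge0// sqr_ge0.
    by rewrite lerBlDr lerDl mulr_ge0// (le_trans bet0).
  have s2 : (A * E) * (1 - bet * h) <= (A * E) * expR (- (bet * h)).
    by apply: ler_wpM2l => //; rewrite mulr_ge0.
  rewrite -natr1.
  nra.
have := ind n (leqnn n); rewrite hn => /le_trans; apply.
rewrite lerD2l.
have -> : n%:R * (C * h ^+ 2) = C * t ^+ 2 / n%:R.
  by rewrite /h; field; rewrite pnatr_eq0.
rewrite ler_pdivrMr// -ler_pdivrMl// (le_trans _ (ltW Mn))//.
by rewrite mulrC /M lerDr addr_ge0.
Qed.
End gronwall.

Section moments.
Context {R : realType}.
Variables (a b c m w : R).
Local Open Scope fset_scope.
Local Open Scope ring_scope.

(** The contribution of a resampling at [j] to the time derivative of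
[phi S = E h_S]. If [j + 1] belongs to [S], the factor [y_(j+1)] meets a second
one, and [y ^ 2 = (1 - 2 * m) * y + m * (1 - m)] has been used. *)
Definition site_drift (phi : {fset int} -> R) (S : {fset int}) (j : int) : R :=
  bias a b c m * phi (S `\ j) +
  (if j + 1 \in S then
     (slope a b c m + quad a b c * (1 - 2 * m)) * phi S
     + slope a b c m * (1 - 2 * m) * phi (S `\ j)
     + slope a b c m * (m * (1 - m)) * phi (S `\ j `\ (j + 1))
     + quad a b c * (m * (1 - m)) * phi (S `\ (j + 1))
   else
     slope a b c m * phi S + slope a b c m * phi ((j + 1) |` (S `\ j))
     + quad a b c * phi ((j + 1) |` S)) - phi S.

(** The equation [d/dt f t S = \sum_(j in S) site_drift (f t) S j], in the form of
a one-step estimate. It passes to time shifts and to differences, and it is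
what the graphical construction gives. *)
Definition solves_moment_equation (f : R -> {fset int} -> R) : Prop :=
  forall S, exists2 C, 0 <= C & forall t h, 0 <= t -> 0 <= h <= 1 ->
    `|f (t + h) S - f t S - h * \sum_(j <- S) site_drift (f t) S j|
      <= C * h ^+ 2.

Definition decay_rate : R := (1 -
  (slope a b c m + `|slope a b c m| + `|quad a b c| * w + `|bias a b c m| / w)) / 2.

(** Chosen so that adding [jump_bound * phi S] to [site_drift phi S j] makes the
coefficient of [phi S] nonnegative: the triangle inequality then loses nothing
on the diagonal. *)
Definition jump_bound : R := 1 + `|slope a b c m| + `|quad a b c|.

Hypotheses (m01 : 0 <= m <= 1) (wE : w = Num.max m (1 - m))
  (contr : contracting a b c m w).

Lemma weight_gt0 : 0 < w.
Proof. by rewrite wE; have [h|h] := leP m (1 - m); lra. Qed.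

Lemma weight_le1 : w <= 1.
Proof. by case/andP: m01 => m0 m1; rewrite wE; have [h|h] := leP m (1 - m); lra. Qed.

(** The larger root of [y ^ 2 = |1 - 2 * m| * y + m * (1 - m)] is [w]. *)
Lemma weight_square : w ^+ 2 = `|1 - 2 * m| * w + m * (1 - m).
Proof.
rewrite wE; have [h|h] := leP m (1 - m).
  by rewrite ger0_norm; [ring|lra].
by rewrite ltr0_norm; [ring|lra].
Qed.

Lemma decay_rate_gt0 : 0 < decay_rate.
Proof. by rewrite /decay_rate divr_gt0// subr_gt0. Qed.

(** Diagonal dominance. The sets in [site_drift] differ from [S] by at most the
sites [j] and [j + 1], so each coefficient enters with a power of [w] between
[-2] and [1]; by [weight_square] the terms that come from [y_(j+1) ^ 2] add up
to the same total as in the case where [j + 1] is not in [S]. *)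
Lemma site_drift_bound (phi : {fset int} -> R) (S : {fset int}) (j : int) N :
  j \in S -> 0 <= N -> (forall T, `|phi T| <= N * w ^+ #|` T|) ->
  `|site_drift phi S j + jump_bound * phi S| <=
     (jump_bound - 2 * decay_rate) * (N * w ^+ #|` S|).
Proof.
move=> jS N0 bphi; have w0 := weight_gt0.
have wn0 : w != 0 by rewrite gt_eqF.
have cS : #|` S| = #|` S `\ j|.+1 by rewrite (cardfsD1 j) jS add1n.
set B := N * w ^+ #|` S|.
have B0 : 0 <= B by rewrite mulr_ge0// exprn_ge0// ltW.
have b1 : `|phi (S `\ j)| <= B / w.
  apply: le_trans (bphi _) _.
  by rewrite /B cS exprS [w * _]mulrC mulrA mulfK.
have /andP[m0 m1] := m01.
have m2 : 0 <= m * (1 - m) by apply: mulr_ge0; lra.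
have k1 : `|1 - 2 * m| <= 1 by rewrite ler_norml; apply/andP; split; lra.
rewrite /site_drift; case: ifPn => j1S.
- have j1Sj : j + 1 \in S `\ j.
    by rewrite in_fsetD1 j1S andbT -subr_eq0 addrAC subrr add0r.
  have b2 : `|phi (S `\ j `\ (j + 1))| <= B / w ^+ 2.
    apply: le_trans (bphi _) _.
    rewrite /B cS (cardfsD1 (j + 1) (S `\ j)) j1Sj add1n 2!exprS [w * (w * _)]mulrA.
    by rewrite -expr2 [w ^+ 2 * _]mulrC mulrA mulfK// expf_neq0.
  have b3 : `|phi (S `\ (j + 1))| <= B / w.
    apply: le_trans (bphi _) _.
    by rewrite /B (cardfsD1 (j + 1) S) j1S add1n exprS [w * _]mulrC mulrA mulfK.
  (* [w ^ 2 = |k| * w + l] says that expanding [y ^ 2 = k * y + l] does not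
   increase weights, so adjacent sites cost no more than distant ones. *)
have wsq := weight_square.
  set x := slope a b c m ; set y := quad a b c .
  set z := bias a b c m .
  set k := 1 - 2 * m in wsq k1 |- *; set l := m * (1 - m) in wsq m2 |- *.
  clearbody k l.
  have c0 : 0 <= jump_bound - 1 + x + y * k.
    rewrite /jump_bound -/x -/y.
    have : - `|x| <= x by rewrite lerNl -normrN ler_norm.
    have : - (`|y| * `|k|) <= y * k by rewrite -normrM lerNl -normrN ler_norm.
    have : `|y| * `|k| <= `|y| by rewrite ler_piMr.
    by lra.
  have -> : z * phi (S `\ j) + ((x + y * k) * phi S + x * k * phi (S `\ j)
     + x * l * phi (S `\ j `\ (j + 1)) + y * l * phi (S `\ (j + 1))) - phi S
     + jump_bound * phi S = (jump_bound - 1 + x + y * k) * phi S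
     + z * phi (S `\ j) + x * k * phi (S `\ j)
     + x * l * phi (S `\ j `\ (j + 1)) + y * l * phi (S `\ (j + 1)) by ring.
  have t1 : `|(jump_bound - 1 + x + y * k) * phi S| <=
            (jump_bound - 1 + x + y * k) * B.
    by rewrite normrM (ger0_norm c0) ler_wpM2l// bphi.
  have t2 : `|z * phi (S `\ j)| <= `|z| * (B / w) by rewrite normrM ler_wpM2l.
  have t3 : `|x * k * phi (S `\ j)| <= `|x| * `|k| * (B / w).
    by rewrite !normrM ler_wpM2l// mulr_ge0.
  have t4 : `|x * l * phi (S `\ j `\ (j + 1))| <= `|x| * l * (B / w ^+ 2).
    by rewrite !normrM (ger0_norm m2) ler_wpM2l// mulr_ge0.
  have t5 : `|y * l * phi (S `\ (j + 1))| <= `|y| * l * (B / w).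
    by rewrite !normrM (ger0_norm m2) ler_wpM2l// mulr_ge0.
  apply: (@le_trans _ _ ((jump_bound - 1 + x + y * k) * B + `|z| * (B / w)
     + `|x| * `|k| * (B / w) + `|x| * l * (B / w ^+ 2) + `|y| * l * (B / w))).
    do 4 (apply: le_trans (ler_normD _ _) _; apply: lerD => //).
  have kl : `|k| + l / w = w.
    by apply: (mulIf wn0); rewrite mulrDl divfK// -expr2 wsq.
  have kl1 : `|k| / w + l / w ^+ 2 = 1.
    by rewrite expr2 invfM mulrA -mulrDl kl divff.
  have yk : y * k + `|y| * (l / w) <= `|y| * w.
    by rewrite -[in leRHS]kl mulrDr lerD2r -normrM ler_norm.
  have -> : (jump_bound - 1 + x + y * k) * B + `|z| * (B / w)
     + `|x| * `|k| * (B / w) + `|x| * l * (B / w ^+ 2) + `|y| * l * (B / w)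
    = (jump_bound - 1 + x + `|z| / w + `|x| * (`|k| / w + l / w ^+ 2)
       + (y * k + `|y| * (l / w))) * B by field.
  rewrite kl1 mulr1 ler_wpM2r// /decay_rate -/x -/y -/z.
  by lra.
- have nj : j + 1 \notin S `\ j by rewrite in_fsetD1 (negbTE j1S) andbF.
  have b2 : `|phi ((j + 1) |` (S `\ j))| <= B.
    by apply: le_trans (bphi _) _; rewrite cardfsU1 nj add1n -cS.
  have b3 : `|phi ((j + 1) |` S)| <= B * w.
    apply: le_trans (bphi _) _.
    by rewrite cardfsU1 j1S add1n exprS [w * _]mulrC mulrA.
  set x := slope a b c m ; set y := quad a b c .
  set z := bias a b c m .
  have c0 : 0 <= jump_bound - 1 + x.
    rewrite /jump_bound -/x -/y.
    have : - `|x| <= x by rewrite lerNl -normrN ler_norm.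
    by have := normr_ge0 y; lra.
  have -> : z * phi (S `\ j) + (x * phi S + x * phi ((j + 1) |` (S `\ j))
     + y * phi ((j + 1) |` S)) - phi S
     + jump_bound * phi S = (jump_bound - 1 + x) * phi S
     + z * phi (S `\ j) + x * phi ((j + 1) |` (S `\ j))
     + y * phi ((j + 1) |` S) by ring.
  have t1 : `|(jump_bound - 1 + x) * phi S| <= (jump_bound - 1 + x) * B.
    by rewrite normrM (ger0_norm c0) ler_wpM2l// bphi.
  have t2 : `|z * phi (S `\ j)| <= `|z| * (B / w) by rewrite normrM ler_wpM2l.
  have t3 : `|x * phi ((j + 1) |` (S `\ j))| <= `|x| * B.
    by rewrite normrM ler_wpM2l.
  have t4 : `|y * phi ((j + 1) |` S)| <= `|y| * (B * w).
    by rewrite normrM ler_wpM2l.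
  apply: (@le_trans _ _ ((jump_bound - 1 + x) * B + `|z| * (B / w)
     + `|x| * B + `|y| * (B * w))).
    do 3 (apply: le_trans (ler_normD _ _) _; apply: lerD => //).
  have -> : (jump_bound - 1 + x) * B + `|z| * (B / w) + `|x| * B
     + `|y| * (B * w) = (jump_bound - 1 + x + `|z| / w + `|x| + `|y| * w) * B.
    by ring.
  rewrite ler_wpM2r// /decay_rate -/x -/y -/z.
  by lra.
Qed.

Lemma decay_rate_le : 2 * decay_rate <= jump_bound.
Proof.
rewrite /decay_rate /jump_bound mulrC divfK//.
have := normr_ge0 (quad a b c); have := normr_ge0 (bias a b c m).
have w0 := weight_gt0.
have x0 : - `|slope a b c m| <= slope a b c m.
  by rewrite lerNl -normrN ler_norm.
have : 0 <= `|bias a b c m| / w by rewrite divr_ge0// ltW.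
have : 0 <= `|quad a b c| * w by rewrite mulr_ge0// ltW.
have := normr_ge0 (slope a b c m).
by lra.
Qed.

(** If [N * exp(- bet * t)] bounds the weighted norm of [g] up to time [T], then
Gronwall at a single [S] replaces [N] by [max K (rho * N)] with [rho < 1]
independent of [S]: the diagonal rate is [jump_bound * #|S|], while the other
terms contribute [(jump_bound - 2 * bet) * #|S|]. Iterating leaves [K]. *)
Lemma moment_decay (g : R -> {fset int} -> R) (B K : R) :
  solves_moment_equation g ->
  (forall t, 0 <= t -> g t fset0 = 0) ->
  (forall t S, 0 <= t -> `|g t S| <= B * w ^+ #|` S|) ->
  0 <= K -> (forall S, `|g 0 S| <= K * w ^+ #|` S|) ->
  forall t S, 0 <= t -> `|g t S| <= K * w ^+ #|` S| * expR (- (decay_rate * t)).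
Proof.
move=> sg g0 gB K0 gK.
set bet := decay_rate; have bet0 : 0 < bet := decay_rate_gt0.
set cc := jump_bound.
have cc0 : 0 < cc.
  by rewrite /cc /jump_bound -addrA ltr_pwDl// addr_ge0.
pose rho := 1 - bet / cc.
have rho0 : 0 <= rho.
  rewrite subr_ge0 ler_pdivrMr// mul1r.
  by have := decay_rate_le; rewrite -/bet -/cc; lra.
have w0 := weight_gt0.
have improve T N : 0 <= N ->
   (forall t S, 0 <= t <= T -> `|g t S| <= N * expR (- (bet * t)) * w ^+ #|` S|) ->
   forall t S, 0 <= t <= T ->
     `|g t S| <= Num.max K (rho * N) * expR (- (bet * t)) * w ^+ #|` S|.
  move=> N0 gN t S /andP[t0 tT].
  have [->|S0] := eqVneq S fset0.
    rewrite g0// normr0 cardfs0 expr0 mulr1 mulr_ge0 ?expR_ge0//.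
    by rewrite le_max K0.
  set A := Num.max K (rho * N) * w ^+ #|` S|.
  have wS : 0 <= w ^+ #|` S| by rewrite exprn_ge0// ltW.
  have A0 : 0 <= A by rewrite mulr_ge0// le_max K0.
  rewrite mulrAC -/A.
  have [C C0 eqC] := sg S.
  have cS : 1 <= (#|` S|%:R : R) by rewrite ler1n cardfs_gt0.
  apply: (@discrete_gronwall _ (g ^~ S) (cc * #|` S|%:R) A C bet T) => //.
  - exact: ltW.
  - have := decay_rate_le; rewrite -/bet -/cc.
    have : cc <= cc * #|` S|%:R by rewrite ler_peMr// ltW.
    by lra.
  - by apply: le_trans (gK S) _; rewrite ler_wpM2r// le_max lexx.
  - move=> s h s0 h01 hD shT.
    have h0 : 0 <= h by case/andP: h01.
    have := eqC s h s0 h01.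
    set E := expR (- (bet * s)); set sm := \sum_(j <- S) _.
    have E0 : 0 <= E by rewrite expR_ge0.
    have smb : `|sm + cc * #|` S|%:R * g s S| <=
        #|` S|%:R * ((cc - 2 * bet) * (N * E * w ^+ #|` S|)).
      have -> : sm + cc * #|` S|%:R * g s S =
          \sum_(j <- S) (site_drift (g s) S j + cc * g s S).
        rewrite big_split/=; congr (_ + _).
        by rewrite big_const_seq count_predT iter_addr_0 -[RHS]mulr_natr mulrAC.
      apply: le_trans (ler_norm_sum _ _ _) _.
      have -> : #|` S|%:R * ((cc - 2 * bet) * (N * E * w ^+ #|` S|)) =
          \sum_(j <- S) ((cc - 2 * bet) * (N * E * w ^+ #|` S|)).
        by rewrite big_const_seq count_predT iter_addr_0 mulr_natl.
      rewrite big_seq [leRHS]big_seq; apply: ler_sum => j jS.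
      apply: site_drift_bound => //; first by rewrite mulr_ge0.
      move=> T'; apply: gN; rewrite s0/= (le_trans _ shT)//.
      by rewrite lerDl.
    have key : #|` S|%:R * ((cc - 2 * bet) * (N * E * w ^+ #|` S|)) <=
        (cc * #|` S|%:R - bet) * (A * E).
      have l1 : N * rho * w ^+ #|` S| * E <= A * E.
        rewrite ler_wpM2r// /A ler_wpM2r// mulrC le_max lexx orbT//.
      have l2 : #|` S|%:R * (cc - 2 * bet) <= (cc * #|` S|%:R - bet) * rho.
        have -> : (cc * #|` S|%:R - bet) * rho =
           cc * #|` S|%:R - bet * #|` S|%:R - bet + bet * (bet / cc).
          by rewrite /rho; field; rewrite gt_eqF.
        have : 0 <= bet * (bet / cc).
          exact: mulr_ge0 (ltW bet0) (divr_ge0 (ltW bet0) (ltW cc0)).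
        have : bet <= bet * #|` S|%:R by rewrite ler_peMr// ltW.
        by lra.
      have nn : 0 <= N * E * w ^+ #|` S| by rewrite !mulr_ge0.
      apply: le_trans (_ : (cc * #|` S|%:R - bet) * rho * (N * E * w ^+ #|` S|) <= _).
        by rewrite mulrA ler_wpM2r.
      have d0 : 0 <= cc * #|` S|%:R - bet.
        have := decay_rate_le; rewrite -/bet -/cc.
        have : cc <= cc * #|` S|%:R by rewrite ler_peMr// ltW.
        by lra.
      have -> : (cc * #|` S|%:R - bet) * rho * (N * E * w ^+ #|` S|) =
        (cc * #|` S|%:R - bet) * (N * rho * w ^+ #|` S| * E) by ring.
      exact: ler_wpM2l.
    move=> main.
    have -> : g (s + h) S = (g (s + h) S - g s S - h * sm)
      + (1 - h * (cc * #|` S|%:R)) * g s S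
      + h * (sm + cc * #|` S|%:R * g s S) by ring.
    have -> : forall x y z : R, x + y + z = y + z + x by move=> *; ring.
    apply: le_trans (ler_normD _ _) _; apply: lerD => //.
    apply: le_trans (ler_normD _ _) _; apply: lerD => //.
      by rewrite normrM ger0_norm// subr_ge0.
    rewrite normrM ger0_norm// -[leRHS]mulrA ler_wpM2l//.
    exact: le_trans smb key.
  - by rewrite t0.
have rho1 : rho < 1 by rewrite ltrBlDr ltrDl divr_gt0.
move=> T S T0.
have wX n : 0 <= w ^+ n by rewrite exprn_ge0// ltW.
rewrite mulrAC.
have B0 : 0 <= B by have := gB 0 fset0 (lexx _); rewrite cardfs0 expr0 mulr1; apply: le_trans.
pose N0 := B * expR (bet * T).
have N00 : 0 <= N0 by rewrite mulr_ge0 ?expR_ge0.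
have ind k : forall t S, 0 <= t <= T ->
    `|g t S| <= Num.max K (rho ^+ k * N0) * expR (- (bet * t)) * w ^+ #|` S|.
  elim: k => [|k ih] t S' tT.
    have /andP[t0 tT'] := tT.
    apply: le_trans (gB t S' t0) _; rewrite ler_wpM2r//.
    rewrite expr0 mul1r.
    apply: (@le_trans _ _ (N0 * expR (- (bet * t)))).
      rewrite /N0 -mulrA -expRD ler_peMr// -expR0 ler_expR.
      by rewrite -mulrBr mulr_ge0 ?subr_ge0// ltW.
    by rewrite ler_wpM2r ?expR_ge0// le_max lexx orbT.
  have mx0 : 0 <= Num.max K (rho ^+ k * N0) by rewrite le_max K0.
  apply: le_trans (improve T _ mx0 ih t S' tT) _.
  rewrite ler_wpM2r// ler_wpM2r ?expR_ge0//.
  rewrite ge_max; apply/andP; split; first by rewrite le_max lexx.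
  rewrite maxr_pMr// ge_max; apply/andP; split.
    by rewrite le_max ler_piMl// ltW.
  by rewrite le_max exprS mulrA lexx orbT.
apply/ler_addgt0Pr => e e0.
(* The a priori bound [N0] depends on the horizon [T], but after enough
   improvements only [K] is left. *)
have [k kP] : exists k, rho ^+ k * N0 <= e.
  have cv : rho ^+ k * N0 @[k --> \oo] --> 0 * N0.
    by apply: cvgMl; apply: cvg_expr; rewrite ger0_norm.
  rewrite mul0r in cv.
  have /cvgrPdist_le/(_ e e0) [k _ /(_ k (leqnn k))] := cv.
  by rewrite sub0r normrN => /(le_trans (ler_norm _)); exists k.
have TT : 0 <= T <= T by rewrite T0 lexx.
apply: le_trans (ind k T S TT) _.
apply: (@le_trans _ _ ((K + e) * expR (- (bet * T)) * w ^+ #|` S|)).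
  rewrite ler_wpM2r// ler_wpM2r ?expR_ge0//.
  by rewrite ge_max lerDl (ltW e0)/= (le_trans kP)// lerDr.
rewrite mulrDl mulrDl lerD2l -mulrA ler_piMr//; first exact: ltW.
apply: mulr_ile1; rewrite ?expR_ge0//.
  by rewrite -expR0 ler_expR oppr_le0 mulr_ge0// ltW.
by rewrite exprn_ile1 ?weight_le1// ltW.
Qed.
End moments.

(** * Expectations, cylinder functions and centred monomials *)

Section bounded_measurable.
Context {R : realType} {d} {T : measurableType d}.

Definition bounded_measurable (f : T -> R) : Prop :=
  measurable_fun setT f /\ exists M, forall x, `|f x| <= M.

Implicit Types f g : T -> R.

Lemma bounded_measurable_cst r : bounded_measurable (fun=> r).
Proof. by split; [exact: measurable_cst|exists `|r|]. Qed.

Lemma bounded_measurableD f g : bounded_measurable f -> bounded_measurable g ->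
  bounded_measurable (fun x => f x + g x).
Proof.
move=> [mf [M fM]] [mg [N gN]]; split; first exact: measurable_funD.
by exists (M + N) => x; rewrite (le_trans (ler_normD _ _))// lerD.
Qed.

Lemma bounded_measurableM f g : bounded_measurable f -> bounded_measurable g ->
  bounded_measurable (fun x => f x * g x).
Proof.
move=> [mf [M fM]] [mg [N gN]]; split; first exact: measurable_funM.
by exists (M * N) => x; rewrite normrM ler_pM.
Qed.

Lemma bounded_measurableZ r f : bounded_measurable f ->
  bounded_measurable (fun x => r * f x).
Proof. by move=> bf; apply: bounded_measurableM => //; exact: bounded_measurable_cst. Qed.

Lemma bounded_measurableB f g : bounded_measurable f -> bounded_measurable g ->
  bounded_measurable (fun x => f x - g x).
Proof.
move=> bf /(bounded_measurableZ (-1)) bg.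
by under eq_fun do rewrite -mulN1r; exact: bounded_measurableD.
Qed.

Lemma bounded_measurable_sum (I : Type) (s : seq I) (F : I -> T -> R) :
  (forall i, bounded_measurable (F i)) ->
  bounded_measurable (fun x => \sum_(i <- s) F i x).
Proof.
move=> bF; elim: s => [|i s ih].
  by under eq_fun do rewrite big_nil; exact: bounded_measurable_cst.
by under eq_fun do rewrite big_cons; exact: bounded_measurableD.
Qed.

Lemma bounded_measurable_indic (A : set T) : measurable A ->
  bounded_measurable (\1_A : T -> R).
Proof.
move=> mA; split; first exact: measurable_indic.
by exists 1 => x; rewrite indicE normr_nat lern1 leq_b1.
Qed.

Section mean.
Variable mu : probability T R.

Definition mean f : R := \int[mu]_x f x.

Lemma bounded_measurable_integrable f : bounded_measurable f ->
  mu.-integrable setT (EFin \o f).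
Proof.
move=> [mf [M fM]]; apply: measurable_bounded_integrable => //.
  by apply: le_lt_trans (ltry 1); exact: (@probability_le1 _ _ _ mu).
exists M; split; first exact: num_real.
by move=> y My x _ /=; rewrite (le_trans (fM x))// ltW.
Qed.

Lemma mean_cst r : mean (fun=> r) = r.
Proof.
rewrite /mean Rintegral_cst// [fine _](_ : _ = 1) ?mulr1//.
by rewrite -[1]/(fine 1%E) -(@probability_setT _ _ _ mu).
Qed.

Lemma meanD f g : bounded_measurable f -> bounded_measurable g ->
  mean (fun x => f x + g x) = mean f + mean g.
Proof.
by move=> bf bg; rewrite /mean RintegralD//; exact: bounded_measurable_integrable.
Qed.

Lemma meanZ r f : bounded_measurable f -> mean (fun x => r * f x) = r * mean f.
Proof.
by move=> bf; rewrite /mean RintegralZl//; exact: bounded_measurable_integrable.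
Qed.

Lemma meanB f g : bounded_measurable f -> bounded_measurable g ->
  mean (fun x => f x - g x) = mean f - mean g.
Proof.
by move=> bf bg; rewrite /mean RintegralB//; exact: bounded_measurable_integrable.
Qed.

Lemma mean_sum (I : Type) (s : seq I) (F : I -> T -> R) :
  (forall i, bounded_measurable (F i)) ->
  mean (fun x => \sum_(i <- s) F i x) = \sum_(i <- s) mean (F i).
Proof.
move=> bF; elim: s => [|i s ih].
  by under [X in mean X]eq_fun do rewrite big_nil; rewrite big_nil mean_cst.
under [X in mean X]eq_fun do rewrite big_cons.
by rewrite meanD ?ih ?big_cons//; exact: bounded_measurable_sum.
Qed.

Lemma mean_indic (A : set T) : measurable A -> mean \1_A = fine (mu A).
Proof. by move=> mA; rewrite /mean /Rintegral integral_indic ?setIT. Qed.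

Lemma le_mean f g : bounded_measurable f -> bounded_measurable g ->
  (forall x, f x <= g x) -> mean f <= mean g.
Proof.
by move=> bf bg fg; apply: le_Rintegral => //; exact: bounded_measurable_integrable.
Qed.

Lemma mean_norm_le f M : bounded_measurable f -> (forall x, `|f x| <= M) ->
  `|mean f| <= M.
Proof.
move=> bf fM; rewrite ler_norml; apply/andP; split.
  have := @le_mean (fun=> - M) f (bounded_measurable_cst _) bf; rewrite mean_cst.
  by apply => x; have := fM x; rewrite ler_norml => /andP[].
have := @le_mean f (fun=> M) bf (bounded_measurable_cst _); rewrite mean_cst.
by apply => x; have := fM x; rewrite ler_norml => /andP[].
Qed.

(** The form in which almost sure identities off a rare event are used. *)
Lemma mean_ae_le f (N : set T) M : bounded_measurable f -> measurable N ->
  0 <= M -> (forall x, `|f x| <= M) -> {ae mu, forall x, ~ N x -> f x = 0} ->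
  `|mean f| <= M * fine (mu N).
Proof.
move=> bf mN M0 fM f0.
have bN : bounded_measurable (fun x => M * \1_N x).
  by apply: bounded_measurableZ; exact: bounded_measurable_indic.
rewrite -mean_indic// -meanZ; last exact: bounded_measurable_indic.
have [mf _] := bf.
have ae_le g : bounded_measurable g -> (forall x, `|g x| = `|f x|) ->
    mean g <= mean (fun x => M * \1_N x).
  move=> bg gf; rewrite /mean /Rintegral.
  have ig := bounded_measurable_integrable bg.
  have iN := bounded_measurable_integrable bN.
  apply: fine_le; [exact: integrable_fin_num|exact: integrable_fin_num|].
  have [mg _] := bg; have [mN' _] := bN.
  apply: (@le_trans _ _ (\int[mu]_x (`|f x|)%:E)%E).
    rewrite -[leRHS](_ : \int[mu]_x (`|g x|)%:E = _)%E; last first.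
      by apply: eq_integral => x _; rewrite gf.
    apply: le_integral => //.
      apply: bounded_measurable_integrable; split; first exact: measurableT_comp.
      by exists M => x; rewrite normr_id gf.
    by move=> x _; rewrite lee_fin ler_norm.
  apply: ae_ge0_le_integral => //.
  - by apply/measurable_EFinP; exact: measurableT_comp.
  - by move=> x _; rewrite lee_fin mulr_ge0.
  - exact/measurable_EFinP.
  - apply: filterS f0 => x fx _; rewrite lee_fin indicE.
    have [xN|/negP xN] := boolP (x \in N); first by rewrite mulr1.
    by rewrite fx ?normr0 ?mulr0//; move=> /mem_set.
rewrite ler_norml; apply/andP; split; last exact: ae_le.
rewrite lerNl -mulN1r -meanZ//; apply: ae_le.
  exact: bounded_measurableZ.
by move=> x; rewrite mulN1r normrN.
Qed.

End mean.
End bounded_measurable.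

Lemma mean_comp {R : realType} {d d'} {T : measurableType d}
    {T' : measurableType d'} (mu : probability T R) (nu : probability T' R)
    (X : T -> T') (f : T' -> R) : measurable_fun setT X ->
  (forall A, measurable A -> nu A = mu (X @^-1` A)) -> bounded_measurable f ->
  mean nu f = mean mu (f \o X).
Proof.
move=> mX nuE bf; rewrite /mean /Rintegral; congr fine.
have [mf [M fM]] := bf.
rewrite (@eq_measure_integral _ _ _ _ (pushforward mu X) nu); last first.
  by move=> A mA _; exact: nuE.
rewrite integral_pushforward//.
- exact/measurable_EFinP.
- apply: (@bounded_measurable_integrable _ _ _ mu (f \o X)); split.
    exact: measurableT_comp.
  by exists M => x; exact: fM.
Qed.

Section cylinder_functions.
Context {R : realType}.

(** Functions of finitely many sites; the sites are given as a sequence to allow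
induction on it. *)
Definition depends_on {T : Type} (s : seq int) (f : config -> T) : Prop :=
  forall x y : config, (forall j, j \in s -> x j = y j) -> f x = f y.

Definition set_site (j : int) (b : bool) (x : config) : config :=
  fun i => if i == j then b else x i.

Lemma depends_on_set_site {T : Type} j s (f : config -> T) b :
  depends_on (j :: s) f -> depends_on s (f \o set_site j b).
Proof.
move=> df x y xy; apply: df => i; rewrite /set_site inE.
by case: eqP => //= _ /xy.
Qed.

Lemma set_site_id j x : set_site j (x j) x = x.
Proof. by apply/funext => i; rewrite /set_site; case: eqP => [->|]. Qed.

Lemma site_split j (f : config -> R) x :
  f x = (x j)%:R * f (set_site j true x)
        + (1 - (x j)%:R) * f (set_site j false x).
Proof.
rewrite -{1}(set_site_id j x).
by case: (x j); rewrite ?mul1r ?mul0r ?subrr ?subr0 ?mul0r ?addr0 ?add0r ?mul1r.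
Qed.

Lemma measurable_site j (b : bool) : measurable [set x : config | x j = b].
Proof. by apply: sub_gen_smallest; exists j, b. Qed.

Lemma bounded_measurable_site j :
  bounded_measurable (fun x : config => (x j)%:R : R).
Proof.
rewrite (_ : (fun _ => _) = \1_[set x : config | x j = true]).
  by apply: bounded_measurable_indic; exact: measurable_site.
apply/funext => x; rewrite indicE (_ : (x \in _) = x j)//.
by apply/idP/idP; rewrite inE.
Qed.

Lemma bounded_measurable_cylinder s (f : config -> R) : depends_on s f ->
  bounded_measurable f.
Proof.
elim: s f => [|j s ih] f df.
  rewrite (_ : f = fun=> f point); first exact: bounded_measurable_cst.
  by apply/funext => x; apply: df.
rewrite (_ : f = fun x => (x j)%:R * f (set_site j true x)
        + (1 - (x j)%:R) * f (set_site j false x)); last first.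
  by apply/funext => x; exact: site_split.
have bs b : bounded_measurable (f \o set_site j b).
  by apply: ih; exact: depends_on_set_site.
apply: bounded_measurableD; apply: bounded_measurableM (bs _).
  exact: bounded_measurable_site.
apply: bounded_measurableB; first exact: bounded_measurable_cst.
exact: bounded_measurable_site.
Qed.

Variable m : R.

Definition monomial (S : {fset int}) (x : config) : R :=
  \prod_(j <- S) ((x j)%:R - m).

Lemma monomial0 x : monomial fset0 x = 1.
Proof. by rewrite /monomial big_seq_fset0. Qed.

Lemma monomialD1 S j x : j \in S ->
  monomial S x = ((x j)%:R - m) * monomial (S `\ j)%fset x.
Proof. by move=> jS; rewrite /monomial (big_fsetD1 j). Qed.

Lemma monomialU1 S j x : j \notin S ->
  monomial (j |` S)%fset x = ((x j)%:R - m) * monomial S x.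
Proof. by move=> jS; rewrite /monomial big_fsetU1. Qed.

Lemma depends_on_monomial (S : {fset int}) : depends_on S (monomial S).
Proof.
move=> x y xy; rewrite /monomial big_seq [RHS]big_seq; apply: eq_bigr => j jS.
by rewrite xy.
Qed.

Lemma bounded_measurable_monomial S : bounded_measurable (monomial S).
Proof. exact: bounded_measurable_cylinder (@depends_on_monomial S). Qed.

Lemma monomial_bound w S x : 0 <= m <= 1 -> w = Num.max m (1 - m) ->
  `|monomial S x| <= w ^+ #|` S|.
Proof.
move=> /andP[m0 m1] ->; rewrite /monomial normr_prod.
rewrite (_ : _ ^+ _ = \prod_(j <- S) Num.max m (1 - m)); last first.
  by rewrite big_const_seq count_predT iter_mulr_1.
apply: ler_prod => j _; rewrite normr_ge0/=.
case: (x j); last by rewrite sub0r normrN ger0_norm// le_max lexx.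
by rewrite ger0_norm ?subr_ge0// le_max lexx orbT.
Qed.

(** By induction on the sites: [f = x_j * f1 + (1 - x_j) * f0] where [f1] and
[f0] do not depend on [j], that is [f = (f1 - f0) * y_j + (m * f1 + (1 - m) * f0)].
The two coefficients are bounded by [2 * M] and [M], whence the factor [3] per
site. *)
Lemma cylinder_seminorm (N : (config -> R) -> R) K :
  (forall f g s t, depends_on s f -> depends_on t g ->
     N (fun x => f x + g x) <= N f + N g) ->
  (forall r T, N (fun x => r * monomial T x) <= `|r| * K) ->
  0 <= m <= 1 -> 0 <= K ->
  forall s f M, depends_on s f -> (forall x, `|f x| <= M) ->
    N f <= 3 ^+ size s * M * K.
Proof.
move=> ND NM /andP[m0 m1] K0 s f M df fM.
suff main : forall u (g : config -> R) (T : {fset int}) B, uniq u ->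
    depends_on u g -> (forall j, j \in u -> j \notin T) ->
    (forall x, `|g x| <= B) ->
    N (fun x => g x * monomial T x) <= 3 ^+ size u * B * K.
  rewrite (_ : f = (fun x => f x * monomial fset0 x)); last first.
    by apply/funext => x; rewrite monomial0 mulr1.
  apply: le_trans (main (undup s) f fset0 M (undup_uniq s) _ _ fM) _ => //.
    by move=> x y xy; apply: df => j js; apply: xy; rewrite mem_undup.
  have M0 : 0 <= M := le_trans (normr_ge0 _) (fM point).
  by rewrite !ler_wpM2r// ler_weXn2l ?size_undup// ler1n.
elim=> [|j u ih] g T B /= => [_ dg _ gB|/andP[ju uu] dg uT gB].
  rewrite (_ : (fun _ => _) = (fun x => g point * monomial T x)); last first.
    by apply/funext => x; congr (_ * _); exact: dg.
  by apply: le_trans (NM _ _) _; rewrite expr0 mul1r ler_wpM2r.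
have jT : j \notin T by apply: uT; rewrite mem_head.
pose g1 x := g (set_site j true x); pose g0 x := g (set_site j false x).
have dg1 : depends_on u g1 by exact: depends_on_set_site dg.
have dg0 : depends_on u g0 by exact: depends_on_set_site dg.
pose k1 x := g1 x - g0 x; pose k0 x := m * g1 x + (1 - m) * g0 x.
have dk1 : depends_on u k1 by move=> x y xy; rewrite /k1 (dg1 _ _ xy) (dg0 _ _ xy).
have dk0 : depends_on u k0 by move=> x y xy; rewrite /k0 (dg1 _ _ xy) (dg0 _ _ xy).
rewrite (_ : (fun _ => _) = fun x =>
    k1 x * monomial (j |` T)%fset x + k0 x * monomial T x); last first.
  apply/funext => x; rewrite monomialU1// (site_split j g).
  by rewrite /k1 /k0 /g1 /g0; ring.
have dp (k : config -> R) (T' : {fset int}) : depends_on u k ->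
    depends_on (u ++ (T' : seq int)) (fun x => k x * monomial T' x).
  move=> dk x y xy; rewrite (dk x y) ?(depends_on_monomial (y := y))// => i ih';
    by apply: xy; rewrite mem_cat ih' ?orbT.
apply: le_trans (ND _ _ _ _ (dp _ _ dk1) (dp _ _ dk0)) _.
have -> : 3 ^+ (size u).+1 * B * K = 3 ^+ size u * (2 * B) * K + 3 ^+ size u * B * K.
  by rewrite exprS; ring.
apply: lerD; apply: ih => //.
- move=> i iu; rewrite in_fset1U negb_or uT ?inE ?iu ?orbT// andbT.
  by apply: contraNneq ju => <-.
- by move=> x; rewrite /k1 (le_trans (ler_normB _ _))// mulr2n mulrDl mul1r lerD ?gB.
- by move=> i iu; apply: uT; rewrite inE iu orbT.
- move=> x; rewrite /k0 (le_trans (ler_normD _ _))// !normrM.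
  rewrite (ger0_norm m0) (@ger0_norm _ (1 - m)) ?subr_ge0//.
  rewrite (_ : B = m * B + (1 - m) * B); last by ring.
  by rewrite lerD// ler_wpM2l ?subr_ge0// gB.
Qed.

End cylinder_functions.

(** * Independence of one source of randomness from all the others *)

Section independence.
Context {R : realType} {d} {Omega : measurableType d}.
Variable Pr : probability Omega R.
Context {I : eqType} (F : I -> set (set Omega)).
Hypothesis Fmeas : forall i A, F i A -> measurable A.
Hypothesis FT : forall i, F i setT.
Hypothesis FI : forall i A B, F i A -> F i B -> F i (A `&` B).
Hypothesis indep : mutually_independent Pr F.

Definition events_of (X : set I) : set (set Omega) :=
  <<s \bigcup_(i in X) F i >>.

Let products (X : set I) : set (set Omega) :=
  [set A | exists s (E : I -> set Omega), [/\ uniq s,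
     forall i, i \in s -> X i /\ F i (E i) &
     A = \big[setI/setT]_(i <- s) E i]].

Lemma events_of_sub X i A : X i -> F i A -> events_of X A.
Proof. by move=> Xi FA; apply: sub_gen_smallest; exists i. Qed.

Lemma events_of_measurable X A : events_of X A -> measurable A.
Proof.
apply: smallest_sub; first exact: sigma_algebra_measurable.
by move=> B [i _]; exact: Fmeas.
Qed.

Lemma events_of_mono X Y : X `<=` Y -> events_of X `<=` events_of Y.
Proof.
move=> XY; apply: smallest_sub; first exact: smallest_sigma_algebra.
move=> A [i Xi FA]; exact: (events_of_sub (XY _ Xi)).
Qed.

Lemma big_setI_extend (s t : seq I) (E : I -> set Omega) : uniq s -> uniq t ->
  {subset s <= t} -> \big[setI/setT]_(i <- s) E i =
  \big[setI/setT]_(i <- t) (if i \in s then E i else setT).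
Proof.
move=> us ut st; rewrite [RHS](bigID (fun i => i \in s)) /=.
rewrite [X in _ `&` X]big1 ?setIT; last by move=> i /negbTE ->.
rewrite [RHS](eq_bigr E); last by move=> i ->.
rewrite -[RHS]big_filter; apply: perm_big; apply: uniq_perm => //.
  exact: filter_uniq.
move=> i; rewrite mem_filter; apply/idP/andP => [is_|[]//].
by split=> //; exact: st.
Qed.

Lemma products_setI X : setI_closed (products X).
Proof.
move=> A B [s [E [us sE ->]]] [t [G [ut tG ->]]].
pose r := undup (s ++ t).
have ur : uniq r by exact: undup_uniq.
have sr : {subset s <= r} by move=> i; rewrite mem_undup mem_cat => ->.
have tr : {subset t <= r} by move=> i; rewrite mem_undup mem_cat orbC => ->.
rewrite (big_setI_extend E us ur sr) (big_setI_extend G ut ur tr) -big_split/=.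
exists r; eexists; split; [exact: ur| |reflexivity] => i.
rewrite mem_undup mem_cat => ist; split.
  by case/orP: ist => [/sE[]|/tG[]].
by apply: FI; case: ifPn => [|_]; [move=> /sE[]| |move=> /tG[]|].
Qed.

(** Finite intersections of source events are stable under intersection and
satisfy the product rule by mutual independence; the events that satisfy it
form a Dynkin system. *)
Lemma events_of_independent X i E B : ~ X i -> events_of X E -> F i B ->
  Pr (E `&` B) = (Pr E * Pr B)%E.
Proof.
move=> nXi XE FB; have mB := Fmeas FB.
pose H := [set A : set Omega | measurable A /\ Pr (A `&` B) = (Pr A * Pr B)%E].
suff: H E by case.
have : <<s products X >> E.
  move: E XE; apply: smallest_sub; first exact: smallest_sigma_algebra.
  move=> A [j Xj FA]; apply: sub_gen_smallest.
  exists [:: j], (fun=> A); split => //.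
    by move=> k; rewrite inE => /eqP ->.
  by rewrite big_seq1.
apply: lambda_system_subset => //.
- exact: products_setI.
- apply/dynkin_lambda_system; split.
  + by split=> //; rewrite setTI probability_setT mul1e.
  + move=> A [mA PA]; split; first exact: measurableC.
    have -> : Pr (~` A `&` B) = (Pr B - Pr (A `&` B))%E.
      rewrite setIC -setDE measureD// 1?setIC//.
      by rewrite -ge0_fin_numE ?fin_num_measure.
    rewrite PA probability_setC//.
    have /fineK <- : Pr A \is a fin_num by rewrite fin_num_measure.
    have /fineK <- : (Pr B : \bar R) \is a fin_num by rewrite fin_num_measure.
    by rewrite -EFinM -!EFinB -EFinM; congr EFin; ring.
  + move=> A tA HA; split.
      by apply: bigcupT_measurable => n; case: (HA n).
    rewrite setI_bigcupl measure_bigcup//=; last 2 first.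
    * by move=> n _; apply: measurableI => //; case: (HA n).
    * exact: trivIset_setIr.
    rewrite measure_bigcup//=; last by move=> n _; case: (HA n).
    have /fineK <- : (Pr B : \bar R) \is a fin_num by rewrite fin_num_measure.
    rewrite muleC -nneseriesZl//; apply: eq_eseriesr => n _.
    by case: (HA n) => _ ->; rewrite muleC fineK ?fin_num_measure.
- move=> A [s [G [us sG ->]]]; split.
    rewrite big_seq; apply: bigsetI_measurable => j /sG[_ ].
    exact: Fmeas.
  have nis : i \notin s by apply/negP => /sG[].
  pose K j := if j == i then B else G j.
  have Ks : \big[setI/setT]_(j <- s) G j = \big[setI/setT]_(j <- s) K j.
    rewrite big_seq [RHS]big_seq; apply: eq_bigr => j js.
    by rewrite /K; case: eqP js nis => // -> ->.
  have := indep (s := i :: s) (E := K).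
  rewrite /= nis us big_cons /= [K i]/K eqxx big_cons.
  rewrite setIC -Ks => -> //; last first.
    move=> j; rewrite inE /K; case: eqP => [->//|_ /= js].
    by case: (sG j js).
  rewrite muleC; congr (_ * _)%E.
  rewrite Ks indep//.
  move=> j js; rewrite /K; case: eqP => [->//|_].
  by case: (sG j js).
by rewrite /K eqxx.
Qed.

End independence.

(** * Clocks and update variables *)

Section laws.
Context {R : realType}.

Lemma exponential_prob_neg : exponential_prob 1 `]-oo, 0 : R] = 0%E.
Proof.
rewrite /exponential_prob -integral_itv_bndo_bndc; last first.
  apply/measurable_EFinP/measurable_funTS.
  exact: measurable_exponential_pdf.
rewrite (eq_integral (fun=> 0%E)) ?integral0// => x.
by rewrite inE/= in_itv/= => x0; rewrite lt0_exponential_pdf.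
Qed.

Lemma exponential_prob_itv (x : R) : 0 <= x ->
  exponential_prob 1 `]-oo, x] = (1 - expR (- x))%:E.
Proof.
rewrite le_eqVlt => /predU1P[<-|x0].
  by rewrite oppr0 expR0 subrr exponential_prob_neg.
rewrite (@itv_bndbnd_setU _ _ -oo%O (BLeft 0) (BRight x))//; last by rewrite bnd_simp ltW.
rewrite {1}/exponential_prob integral_setU_EFin//=; last 2 first.
- apply/measurable_funTS; exact: measurable_exponential_pdf.
- apply/disj_setPS => y [/=]; rewrite !in_itv/= => y0 /andP[].
  by rewrite leNgt y0.
rewrite -/(exponential_prob 1 _) -/(exponential_prob 1 _).
rewrite exponential_prob_itv0c//.
rewrite (_ : exponential_prob _ _ = 0%E); last first.
  rewrite /exponential_prob (eq_integral (fun=> 0%E)) ?integral0// => y.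
  by rewrite inE/= in_itv/= => y0; rewrite lt0_exponential_pdf.
by rewrite add0e mulN1r EFinB.
Qed.

Lemma uniform_prob_lt (p : R) : 0 <= p <= 1 ->
  uniform_prob (@ltr01 R) `]-oo, p[ = p%:E.
Proof.
move=> /andP[p0 p1]; rewrite /uniform_prob integral_uniform_pdf.
rewrite (eq_integral (fun=> 1%E)); last first.
  move=> x; rewrite inE/= !in_itv/= /uniform_pdf => -[x1 x2].
  by rewrite x2 subr0 invr1.
rewrite integral_cst//=; last exact: measurableI.
have -> : [set` `]-oo, p[] `&` [set` `[0, 1]] = [set` `[0, p[].
  apply/seteqP; split => x /=; rewrite !in_itv/=.
    by move=> [-> /andP[->]].
  by move=> /andP[-> xp]; rewrite xp; split=> //; rewrite (le_trans (ltW xp)).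
rewrite lebesgue_measure_itv/= lte_fin mul1e.
by case: (ltgtP 0 p) p0 => // [_ _|<- _]; rewrite ?oppr0 ?adde0 ?sube0.
Qed.

End laws.

Lemma ae_countable {d} {T : measurableType d} {R : realType}
    (mu : {measure set T -> \bar R}) (K : countType) (Q : K -> T -> Prop) :
  (forall k, {ae mu, forall x, Q k x}) -> {ae mu, forall x, forall k, Q k x}.
Proof.
move=> QK; pose Q' n x := if @choice.unpickle K n is Some k then Q k x else True.
have : {ae mu, forall x, forall n, Q' n x}.
  apply/ae_foralln => n; rewrite /Q'; case: (@choice.unpickle K n) => [k|]//.
  exact: aeW.
by apply: filterS => x Qx k; have := Qx (choice.pickle k); rewrite /Q' choice.pickleK.
Qed.

Section ips.
Context {R : realType} {P : bool -> bool -> bool -> R}.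
Context {d} {Omega : measurableType d} {Pr : probability Omega R}.
Variables (W U : int -> nat -> {RV Pr >-> R}) (zeta : R -> Omega -> config).
Hypothesis ips : is_IPS P W U zeta.

Definition ips_index : eqType := (unit + int * nat + int * nat)%type.

Definition source_events (i : ips_index) : set (set Omega) :=
  match i with
  | inl (inl _) => generated_events (zeta 0)
  | inl (inr (j, n)) => generated_events (W j n)
  | inr (j, n) => generated_events (U j n)
  end.

Definition waiting_index (j : int) (n : nat) : ips_index := inl (inr (j, n)).
Definition update_index (j : int) (n : nat) : ips_index := inr (j, n).

Lemma source_events_measurable i A : source_events i A -> measurable A.
Proof.
have z0 := IPS_measurable ips (lexx 0).
case: i => [[u|[j n]]|[j n]] /= [B mB <-].
- exact: z0.
- by rewrite setTI; exact: measurable_funPTI.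
- by rewrite setTI; exact: measurable_funPTI.
Qed.

Lemma source_eventsT i : source_events i setT.
Proof.
by case: i => [[u|[j n]]|[j n]]; exists setT => //; rewrite setTI preimage_setT.
Qed.

Lemma source_eventsI i A B :
  source_events i A -> source_events i B -> source_events i (A `&` B).
Proof.
case: i => [[u|[j n]]|[j n]] /= [A' mA <-] [B' mB <-]; exists (A' `&` B');
  rewrite ?preimage_setI ?setTI//; exact: measurableI.
Qed.

Lemma independent_source X i E B : ~ X i -> events_of source_events X E ->
  source_events i B -> Pr (E `&` B) = (Pr E * Pr B)%E.
Proof.
apply: events_of_independent.
- exact: source_events_measurable.
- exact: source_eventsT.
- exact: source_eventsI.
- have := IPS_independent ips.
  by congr mutually_independent; apply/funext => -[[u|[j n]]|[j n]].
Qed.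

Lemma waiting_time_tail j n x : 0 <= x ->
  Pr [set w | x < W j n w] = (expR (- x))%:E.
Proof.
move=> x0.
have -> : [set w | x < W j n w] = ~` (W j n @^-1` `]-oo, x]).
  apply/seteqP; split => w /=; rewrite in_itv/=.
    by move=> xw; apply/negP; rewrite -ltNge.
  by move=> /negP; rewrite -ltNge.
rewrite probability_setC; last exact: measurable_funPTI.
have -> : Pr (W j n @^-1` `]-oo, x]) = (1 - expR (- x))%:E.
  rewrite -exponential_prob_itv//.
  by rewrite -(IPS_waiting_time ips j n).
by rewrite -EFinB subKr.
Qed.

Lemma update_prob j n p : 0 <= p <= 1 ->
  Pr [set w | U j n w < p] = p%:E.
Proof.
move=> p01; rewrite -(uniform_prob_lt p01) -(IPS_uniform ips j n)//.
Qed.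

Lemma waiting_time_pos : {ae Pr, forall w, forall j n, 0 < W j n w}.
Proof.
suff : {ae Pr, forall w, forall k : int * nat, 0 < W k.1 k.2 w}.
  by apply: filterS => w Ww j n; exact: (Ww (j, n)).
apply: ae_countable => -[j n] /=.
exists (W j n @^-1` `]-oo, 0]); split.
- exact: measurable_funPTI.
- by rewrite -exponential_prob_neg -(IPS_waiting_time ips j n).
- by move=> w /=; rewrite in_itv/= => /negP; rewrite -leNgt.
Qed.

(** The first [m] waiting times are all at most [t] with probability
[(1 - exp(- t)) ^ m]. *)
Lemma long_waiting_time (idx : nat -> int * nat) t : injective idx -> 0 <= t ->
  {ae Pr, forall w, exists k, t < W (idx k).1 (idx k).2 w}.
Proof.
move=> inj t0.
pose B k := W (idx k).1 (idx k).2 @^-1` `]-oo, t].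
have mB k : measurable (B k) by exact: measurable_funPTI.
exists (\bigcap_k B k); split.
- exact: bigcapT_measurable.
- have bnd m : (Pr (\bigcap_k B k) <= ((1 - expR (- t)) ^+ m)%:E)%E.
    have -> : ((1 - expR (- t)) ^+ m)%:E = (\prod_(i < m) Pr (B i))%E.
      have E i : Pr (B i) = (1 - expR (- t))%:E.
        rewrite -exponential_prob_itv//.
        by rewrite -(IPS_waiting_time ips (idx i).1 (idx i).2).
      under eq_bigr do rewrite E.
      by rewrite prodEFin prodr_const card_ord.
    pose s := [seq waiting_index (idx i).1 (idx i).2 | i <- index_iota 0 m].
    pose G (i : ips_index) : set Omega :=
      if i is inl (inr (j, n)) then W j n @^-1` `]-oo, t] else setT.
    have us : uniq s.
      rewrite map_inj_uniq ?iota_uniq// => x y [] e1 e2.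
      by apply: inj; rewrite (surjective_pairing (idx x)) e1 e2 -surjective_pairing.
    have := IPS_independent ips (s := s) (E := G) us.
    rewrite /s !big_map big_mkord /= => iP.
    rewrite big_mkord in iP.
    rewrite -iP; last first.
      move=> i /mapP[k _ ->] /=; exists `]-oo, t]%classic => //.
      by rewrite setTI.
    apply: le_measure; rewrite ?inE.
    + exact: bigcapT_measurable.
    + by apply: bigsetI_measurable => i _; exact: mB.
    + by rewrite -(bigcap_mkord m B) => w Bw k _; exact: Bw.
  have e1 : `|1 - expR (- t)| < 1.
    have := expR_gt0 (- t) => e0.
    have : expR (- t) <= 1 by rewrite -expR0 ler_expR oppr_le0.
    by move=> ?; rewrite ger0_norm; lra.
  apply/eqP; rewrite -measure_le0; apply/lee_addgt0Pr => e e0.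
  rewrite add0e.
  have /cvgrPdist_le/(_ e e0) [m _ /(_ m (leqnn m))] := cvg_expr e1.
  rewrite sub0r normrN => /(le_trans (ler_norm _)) h.
  by apply: le_trans (bnd m) _; rewrite lee_fin.
- move=> w /= nex k _; rewrite /B /= in_itv /= leNgt; apply/negP => h.
  by apply: nex; exists k.
Qed.

(** The time of the [n]-th ring, with [arrival j 0 = 0]; the ring numbered [n]
from [0] takes place at [arrival j n.+1]. *)
Definition arrival (j : int) (n : nat) (w : Omega) : R :=
  \sum_(k < n) W j k w.

Lemma arrival0 j w : arrival j 0 w = 0.
Proof. by rewrite /arrival big_ord0. Qed.

Lemma arrivalS j n w : arrival j n.+1 w = arrival j n w + W j n w.
Proof. by rewrite /arrival big_ord_recr. Qed.

Lemma ring_timeE j n w : ring_time W j n w = arrival j n.+1 w.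
Proof. by []. Qed.

(** A single waiting time longer than [t] is enough. *)
Lemma arrival_unbounded t : 0 <= t ->
  {ae Pr, forall w, forall j, exists n, t < arrival j n w}.
Proof.
move=> t0.
have : {ae Pr, forall w, forall j, exists n, t < W j n w}.
  apply: ae_countable => j.
  by apply: (@long_waiting_time (fun n => (j, n)) t) => // x y [].
apply: filterS2 waiting_time_pos => w pos lw j.
have [n tn] := lw j; exists n.+1; rewrite arrivalS.
rewrite (lt_le_trans tn)// lerDr sumr_ge0// => k _.
exact/ltW/pos.
Qed.

(** Such a site does not feel its right neighbour up to time [t], so that the
sites to its left evolve autonomously. *)
Lemma silent_site t (K0 : int) : 0 <= t ->
  {ae Pr, forall w, exists k : nat, t < W (K0 + k%:Z) 0 w}.
Proof.
move=> t0; apply: (@long_waiting_time (fun k => (K0 + k%:Z, 0%N))) => //.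
by move=> x y [] /addrI [].
Qed.

End ips.

(** * Reconstruction of a trajectory from the rings *)

(** The letters form a discrete space, so a left limit is attained just before
[tau]. *)
Lemma left_limit_bool {R : realType} (f : R -> bool) (tau a : R) (u b : bool) :
  f s @[s --> tau^'-] --> u -> a < tau ->
  (forall s, a < s -> s < tau -> f s = b) -> u = b.
Proof.
move=> fu at_ fb.
have nu : nbhs u [set u] by exact: discrete_set1.
have e1 : \forall s \near tau^'-, f s = u by exact: (fu _ nu).
have e2 : \forall s \near tau^'-, a < s by exact: nbhs_left_gt.
have e3 : \forall s \near tau^'-, s < tau by exact: nbhs_left_lt.
have e4 : \forall s \near tau^'-, u = b.
  near=> s; have <- : f s = u by near: s.
  by apply: fb; near: s.
exact: (@filter_const _ (tau^'-) _ _ e4).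
Unshelve. all: by end_near. Qed.

Section dynamics.
Context {R : realType} {P : bool -> bool -> bool -> R}.
Context {d} {Omega : measurableType d} {Pr : probability Omega R}.
Variables (W U : int -> nat -> {RV Pr >-> R}) (zeta : R -> Omega -> config).
Hypothesis ips : is_IPS P W U zeta.

Local Notation arrival := (arrival W).

(** The almost sure properties of a realisation from which its states up to time
[t] can be reconstructed. *)
Record regular (t : R) (w : Omega) : Prop := {
  regular_pos : forall j n, 0 < W j n w;
  regular_unbounded : forall j, exists n, t < arrival j n w;
  regular_silent : forall K0 : int, exists k : nat, t < W (K0 + k%:Z) 0 w;
  regular_update : forall j n, exists u v : bool,
      [/\ zeta s w j @[s --> (ring_time W j n w)^'-] --> u,
          zeta s w (j + 1) @[s --> (ring_time W j n w)^'-] --> v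
        & zeta (ring_time W j n w) w j = (U j n w < P true u v)];
  regular_constant : forall (j : int) (s t : R), 0 <= s -> s <= t ->
    (forall n, ~ (s < ring_time W j n w <= t)) -> zeta t w j = zeta s w j
}.

Lemma regular_ae t : 0 <= t -> {ae Pr, forall w, regular t w}.
Proof.
move=> t0; near=> w; split.
- near: w; exact: waiting_time_pos ips.
- near: w; exact: arrival_unbounded ips _ t0.
- near: w; apply: ae_countable => K0; exact: (silent_site ips K0 t0).
- near: w; exact: IPS_update ips.
- near: w; exact: IPS_constant ips.
Unshelve. all: by end_near. Qed.

(** The number of rings by time [t] is [n]. The condition bears on all earlier
arrivals so that these events are disjoint for different [n] on the whole
probability space, also where a waiting time is not positive. *)
Definition clock_at (t : R) (j : int) (n : nat) (w : Omega) : Prop :=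
  (forall m, (m <= n)%N -> arrival j m w <= t) /\ t < arrival j n.+1 w.

Lemma clock_at_unique t j m n w : clock_at t j m w -> clock_at t j n w -> m = n.
Proof.
move=> [m1 m2] [n1 n2]; apply/eqP; rewrite eqn_leq; apply/andP; split.
  by rewrite leqNgt; apply/negP => /m1; rewrite leNgt n2.
by rewrite leqNgt; apply/negP => /n1; rewrite leNgt m2.
Qed.

Lemma clock_at_exists t j w : 0 <= t -> (exists n, t < arrival j n w) ->
  exists n, clock_at t j n w.
Proof.
move=> t0 ex; case: (ex_minnP ex) => -[|n] tn mn.
  by move: tn; rewrite arrival0 ltNge t0.
exists n; split=> // m mn'; rewrite leNgt; apply/negP => /mn.
by rewrite leqNgt ltnS mn'.
Qed.

Section fixed_time.
Variable t : R.
Hypothesis t0 : 0 <= t.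
Variable w : Omega.
Hypothesis reg : regular t w.

Lemma arrival_le j m n : (m <= n)%N -> arrival j m w <= arrival j n w.
Proof.
elim: n => [|n ih]; first by rewrite leqn0 => /eqP ->.
rewrite leq_eqVlt => /predU1P[->//|]; rewrite ltnS => /ih h.
by rewrite arrivalS (le_trans h)// lerDl ltW// (regular_pos reg).
Qed.

Lemma arrival_lt j m n : (m < n)%N -> arrival j m w < arrival j n w.
Proof.
move=> mn; apply: lt_le_trans (arrival_le j mn).
by rewrite arrivalS ltrDl (regular_pos reg).
Qed.

Lemma arrival_ge0 j n : 0 <= arrival j n w.
Proof. by rewrite -(arrival0 W j w); exact: arrival_le. Qed.

Lemma state_between_rings i n s : arrival i n w <= s -> s < arrival i n.+1 w ->
  zeta s w i = zeta (arrival i n w) w i.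
Proof.
move=> ns sn; apply: (regular_constant reg) => //; first exact: arrival_ge0.
move=> k /andP[]; rewrite ring_timeE => kn ks.
have [h|h] := leqP n k.
  by have := arrival_le i (h : (n.+1 <= k.+1)%N); rewrite leNgt (le_lt_trans ks).
by have := arrival_le i h; rewrite leNgt kn.
Qed.

Lemma state_at_ring i n e :
  arrival (i + 1) e w < arrival i n.+1 w ->
  arrival i n.+1 w <= arrival (i + 1) e.+1 w ->
  zeta (arrival i n.+1 w) w i = (U i n w <
    P true (zeta (arrival i n w) w i) (zeta (arrival (i + 1) e w) w (i + 1))).
Proof.
move=> en ne; have [u [v [lu lv ->]]] := regular_update reg i n.
rewrite ring_timeE in lu lv.
have nn : arrival i n w < arrival i n.+1 w by exact: arrival_lt.
rewrite (left_limit_bool lu nn (b := zeta (arrival i n w) w i)).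
  rewrite (left_limit_bool lv en (b := zeta (arrival (i + 1) e w) w (i + 1)))//.
  move=> s s1 s2; apply: state_between_rings; first exact: ltW.
  exact: lt_le_trans ne.
by move=> s s1 s2; apply: state_between_rings => //; exact: ltW.
Qed.

End fixed_time.
End dynamics.

(** * Events determined before the next ring *)

Section traces.
Context {R : realType} {P : bool -> bool -> bool -> R}.
Context {d} {Omega : measurableType d} {Pr : probability Omega R}.
Variables (W U : int -> nat -> {RV Pr >-> R}) (zeta : R -> Omega -> config).
Hypothesis ips : is_IPS P W U zeta.

Local Notation arr := (arrival W).
Local Notation source := (source_events W U zeta).

(** All sources except those of the next ring at [j] when [n] rings have already
taken place. *)
Definition others (j : int) (n : nat) : set ips_index :=
  [set i | i <> waiting_index j n /\ i <> update_index j n].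

(** For fixed [j] and [n] these events form a sigma-algebra, so that the states at
time [t] can be shown to be determined by the other sources without being
written as explicit functions of them. *)
Definition determined (t : R) (j : int) (n : nat) (A : set Omega) : Prop :=
  exists2 B, events_of source (others j n) B &
    {ae Pr, forall w, clock_at W t j n w -> (A w <-> B w)}.

Section fixed.
Variables (t : R) (j0 : int) (n0 : nat).
Hypothesis t0 : 0 <= t.

Local Notation det := (determined t j0 n0).

Definition other_type : Type :=
  g_sigma_algebraType (\bigcup_(i in others j0 n0) source i).
HB.instance Definition _ := Measurable.on other_type.

Lemma determined_measurable (A : set Omega) :
  measurable (A : set other_type) -> det A.
Proof. by move=> mA; exists A => //; exact: aeW. Qed.

Lemma determined_ae A B :
  {ae Pr, forall w, clock_at W t j0 n0 w -> (A w <-> B w)} -> det B -> det A.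
Proof.
move=> AB [B' mB BB']; exists B' => //.
by apply: filterS2 AB BB' => w h1 h2 c; rewrite h1// h2.
Qed.

Lemma determined_not A : det A -> det [set w | ~ A w].
Proof.
move=> [B mB AB]; exists (~` B).
  exact: (@measurableC _ other_type).
by apply: filterS AB => w h c /=; rewrite h.
Qed.

Lemma determined_exists (K : countType) (A : K -> set Omega) :
  (forall k, det (A k)) -> det [set w | exists k, A k w].
Proof.
move=> dA.
have [B BP] := choice (fun k => (exists2P _ _).1 (dA k)).
pose C n : set Omega := if @choice.unpickle K n is Some k then B k else set0.
exists (\bigcup_n C n).
  apply: (@bigcupT_measurable _ other_type) => n; rewrite /C.
  case: (@choice.unpickle K n) => [k|]; first by have [] := BP k.
  exact: (@measurable0 _ other_type).
have : {ae Pr, forall w, forall k, clock_at W t j0 n0 w -> (A k w <-> B k w)}.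
  by apply: ae_countable => k; have [] := BP k.
apply: filterS => w h c; split => [[k /= /h Bk]|[n _]].
  by exists (choice.pickle k) => //; rewrite /C choice.pickleK; exact: Bk.
rewrite /C; case: (@choice.unpickle K n) => [k|//] Bk.
by exists k; apply/(h k c).
Qed.

Lemma determined_or A B : det A -> det B -> det [set w | A w \/ B w].
Proof.
move=> dA dB; have := @determined_exists bool (fun b => if b then A else B).
move=> /(_ _)/wrap[]; first by case.
apply: determined_ae; apply: aeW => w _; split=> [[]|[[]]] //=;
  by [exists true|exists false|left|right].
Qed.

Lemma determined_and A B : det A -> det B -> det [set w | A w /\ B w].
Proof.
move=> /determined_not dA /determined_not dB.
have := determined_not (determined_or dA dB).
apply: determined_ae; apply: aeW => w _ /=; split => [[a b] []//|ab].
by split; apply: contrapT => n; apply: ab; [left|right].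
Qed.

Lemma measurable_source i A : others j0 n0 i -> source i A ->
  measurable (A : set other_type).
Proof. by move=> oi sA; apply: sub_gen_smallest; exists i. Qed.

Lemma other_waiting_time i n : (i, n) <> (j0, n0) ->
  measurable_fun setT (W i n : other_type -> R).
Proof.
move=> ne _ B mB; rewrite setTI; apply: (@measurable_source (waiting_index i n)).
  by split=> // -[] ? ?; apply: ne; congr pair.
by exists B => //; rewrite setTI.
Qed.

Lemma other_update i n : (i, n) <> (j0, n0) ->
  measurable_fun setT (U i n : other_type -> R).
Proof.
move=> ne _ B mB; rewrite setTI; apply: (@measurable_source (update_index i n)).
  by split=> // -[] ? ?; apply: ne; congr pair.
by exists B => //; rewrite setTI.
Qed.

(** Arrivals at [j0] after the [n0]-th ring involve excluded waiting times.
Replacing them by the constant [t + 1] does not change their order relative to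
times up to [t]. *)
Definition frozen_arrival (i : int) (n : nat) : other_type -> R :=
  if (i == j0) && (n0 < n)%N then cst (t + 1) else arr i n.

Lemma measurable_frozen_arrival i n : measurable_fun setT (frozen_arrival i n).
Proof.
rewrite /frozen_arrival; case: ifPn => [_|/negbTE ne].
  exact: measurable_cst.
rewrite /arrival/=.
suff : forall m, (m <= n)%N ->
    measurable_fun setT (fun w : other_type => \sum_(k < m) W i k w).
  exact.
elim=> [|m ih] mn.
  rewrite (_ : (fun _ => _) = cst 0); first exact: measurable_cst.
  by apply/funext => w; rewrite big_ord0.
rewrite (_ : (fun _ => _) = (fun w => \sum_(k < m) W i k w + W i m w)); last first.
  by apply/funext => w; rewrite big_ord_recr.
apply: measurable_funD; first exact: (ih (ltnW mn)).
apply: other_waiting_time => -[ij mn0].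
by rewrite ij eqxx/= -mn0 mn in ne.
Qed.

Lemma regular_frozen w i n : @regular _ P _ _ _ W U zeta t w -> clock_at W t j0 n0 w ->
  (frozen_arrival i n w = arr i n w) \/
  (t < frozen_arrival i n w /\ t < arr i n w).
Proof.
move=> reg [_ c]; rewrite /frozen_arrival.
case: ifPn => [/andP[/eqP -> n0n]|_]; [right|by left].
split; first by rewrite ltrDl.
exact: lt_le_trans c (arrival_le reg j0 n0n).
Qed.

Lemma determined_arrival i n : det [set w | arr i n w <= t].
Proof.
have := @determined_measurable [set w : other_type | frozen_arrival i n w <= t].
move=> /(_ _)/wrap[].
  rewrite (_ : mkset _ = setT `&` frozen_arrival i n @^-1` `]-oo, t]).
    by apply: measurable_frozen_arrival.
  by rewrite setTI; apply/seteqP; split => w /=; rewrite in_itv.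
apply: determined_ae; apply: filterS (regular_ae ips t0) => w reg c /=.
case: (regular_frozen i n reg c) => [->//|[]].
by rewrite !ltNge => /negP h1 /negP h2.
Qed.

Lemma determined_order i n i' n' :
  det [set w | arr i n w < arr i' n' w /\ arr i' n' w <= t].
Proof.
have mf : measurable_fun setT
  (fun w => frozen_arrival i n w < frozen_arrival i' n' w).
  by apply: measurable_fun_ltr; exact: measurable_frozen_arrival.
have := @determined_measurable
  (setT `&` (fun w => frozen_arrival i n w < frozen_arrival i' n' w) @^-1` [set true]).
move=> /(_ _)/wrap[]; first exact: mf.
move=> /determined_and/(_ (determined_arrival i' n')).
apply: determined_ae; apply: filterS (regular_ae ips t0) => w reg c /=.
split => [[h1 h2]|[[_ h1] h2]].
  split=> //; split=> //; move: h1.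
  case: (regular_frozen i n reg c) => [->|[_ h]].
    case: (regular_frozen i' n' reg c) => [->//|[_ h']].
    by move: h2; rewrite leNgt h'.
  by move=> /lt_le_trans/(_ h2); rewrite ltNge (ltW h).
split=> //; move: h1.
case: (regular_frozen i' n' reg c) => [->|[_ h']]; last first.
  by move: h2; rewrite leNgt h'.
case: (regular_frozen i n reg c) => [->//|[h _]].
by move=> /lt_le_trans/(_ h2); rewrite ltNge (ltW h).
Qed.

(** The only excluded update variable is used at a ring after time [t]. *)
Lemma determined_update i n p :
  det [set w | arr i n.+1 w <= t /\ U i n w < p].
Proof.
have [[-> ->]|ne] := pselect ((i, n) = (j0, n0)).
  have := @determined_measurable set0 (@measurable0 _ other_type).
  apply: determined_ae; apply: aeW => w [_ h] /=; split=> // -[].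
  by rewrite leNgt h.
apply: determined_and; first exact: determined_arrival.
suff : det (setT `&` U i n @^-1` `]-oo, p[).
  by apply: determined_ae; apply: aeW => w _ /=; rewrite in_itv/=; split=> [|[]].
by apply: determined_measurable; apply: (other_update ne).
Qed.

Lemma determined_start i u : det [set w | zeta 0 w i = u].
Proof.
apply: determined_measurable.
apply: (@measurable_source (inl (inl tt))); first by split.
exists [set x : config | x i = u]; last by rewrite setTI.
by apply: sub_gen_smallest; exists i, u.
Qed.

Lemma determined_silent K : (j0 < K)%R -> det [set w | t < W K 0%N w].
Proof.
move=> jK; apply: determined_measurable.
rewrite (_ : mkset _ = setT `&` W K 0 @^-1` `]t, +oo[).
  apply: other_waiting_time => // -[e _].
  by rewrite e ltxx in jK.
by rewrite setTI; apply/seteqP; split => w /=; rewrite in_itv/= andbT.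
Qed.

(** Induction on the distance [p] to the silent site [K], then on the number of
rings. The letter after ring [n] is obtained from the letter at [i] after the
previous ring and from the letter at [i + 1] after its last ring [e] before
that time; one takes the union over [e] and over the values of both letters. *)
Lemma determined_state_at_ring K (p : nat) n u : (j0 < K)%R ->
  det [set w | (t < W K 0%N w /\ arr (K - p%:Z) n w <= t) /\
       zeta (arr (K - p%:Z) n w) w (K - p%:Z) = u].
Proof.
move=> jK; have dS := determined_silent jK.
elim: p n u => [|p ihp] n u.
  rewrite subr0; case: n => [|n].
    apply: determined_ae (determined_and dS (determined_start K u)).
    apply: aeW => w _ /=; rewrite arrival0.
    by split => [[[]]|[]].
  have := @determined_measurable set0 (@measurable0 _ other_type).
  apply: determined_ae; apply: filterS (regular_ae ips t0) => w reg _ /=.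
  split=> // -[[h1 h2] _]; move: h2; rewrite leNgt => /negP; apply.
  apply: lt_le_trans (arrival_le reg K (isT : 1 <= n.+1)%N).
  by rewrite arrivalS arrival0 add0r.
elim: n u => [|n ihn] u.
  apply: determined_ae (determined_and dS (determined_start (K - p.+1%:Z) u)).
  apply: aeW => w _ /=; rewrite arrival0.
  by split => [[[]]|[]].
set i := K - p.+1%:Z.
have i1 : i + 1 = K - p%:Z by rewrite /i -addn1 PoszD opprD addrA subrK.
pose step (e : nat) (u1 u2 : bool) : set Omega := [set w |
  ((((t < W K 0%N w /\ arr i n w <= t) /\ zeta (arr i n w) w i = u1) /\
  ((t < W K 0%N w /\ arr (i + 1) e w <= t) /\
     zeta (arr (i + 1) e w) w (i + 1) = u2)) /\
  ((arr (i + 1) e w < arr i n.+1 w /\ arr i n.+1 w <= t) /\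
   ~ (arr (i + 1) e.+1 w < arr i n.+1 w /\ arr i n.+1 w <= t))) /\
  (if u then (arr i n.+1 w <= t /\ U i n w < P true u1 u2)
   else ~ (arr i n.+1 w <= t /\ U i n w < P true u1 u2))].
have dstep e u1 u2 : det (step e u1 u2).
  apply: determined_and; first apply: determined_and; first apply: determined_and.
  - exact: ihn.
  - by rewrite i1; exact: ihp.
  - apply: determined_and; first exact: determined_order.
    by apply: determined_not; exact: determined_order.
  - case: u {ihn step}; first exact: determined_update.
    by apply: determined_not; exact: determined_update.
have := @determined_exists _ _ (fun k : nat * (bool * bool) => dstep k.1 k.2.1 k.2.2).
apply: determined_ae; apply: filterS (regular_ae ips t0) => w reg c /=.
split; last first.
  move=> [[e [u1 u2]]] /= [] [] [] [] [silent _] z1 [_ z2] [] [r1 it] r2 hu.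
  have e2 : arr i n.+1 w <= arr (i + 1) e.+1 w.
    by rewrite leNgt; apply/negP => h; exact: r2.
  split=> //; rewrite (state_at_ring reg r1 e2) z1 z2.
  case: (u) hu => [[]//|h].
  by apply/negbTE/negP => h'; apply: h.
move=> [[silent it] zu].
  have ex : exists e, arr i n.+1 w <= arr (i + 1) e w.
    have [e he] := regular_unbounded reg (i + 1).
    by exists e; rewrite (le_trans it)// ltW.
  have arr_pos : 0 < arr i n.+1 w.
    by rewrite -(arrival0 W i w); exact: (arrival_lt reg).
  have [e [e1 e2]] : exists e, arr (i + 1) e w < arr i n.+1 w /\
      arr i n.+1 w <= arr (i + 1) e.+1 w.
    case: (ex_minnP ex) => -[|e] he me.
      by move: he; rewrite arrival0 leNgt arr_pos.
    exists e; split=> //; rewrite ltNge; apply/negP => /me.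
    by rewrite ltnn.
  have itn : arr i n w <= t by apply: le_trans (arrival_le reg i (leqnSn n)) it.
  exists (e, (zeta (arr i n w) w i, zeta (arr (i + 1) e w) w (i + 1))).
  have it' : arr (i + 1) e w <= t by exact: le_trans (ltW e1) it.
  rewrite /step /=; split; [split; [split|split]|].
  - by [].
  - by [].
  - by [].
  - by move=> []; rewrite ltNge e2.
  - move: zu; rewrite (state_at_ring reg e1 e2).
    by case: (u) => [->//|] => /negbT/negP h [].
Qed.

Lemma determined_state i u : det [set w | zeta t w i = u].
Proof.
(* Starting the search for a silent site to the right of [j0] ensures that its
   first waiting time is among the allowed variables. *)
pose K0 : int := Num.max i (j0 + 1).
have jK k : (j0 < K0 + k%:Z)%R.
  by rewrite (@lt_le_trans _ _ (j0 + 1))// ?ltrDl// ler_wpDr// /K0 le_max lexx orbT.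
have iK k : exists p : nat, i = K0 + k%:Z - p%:Z.
  have : i <= K0 + k%:Z by rewrite ler_wpDr// /K0 le_max lexx.
  rewrite -subr_ge0 => h; exists (absz (K0 + k%:Z - i)%R).
  by rewrite gez0_abs// subKr.
pose step (k n : nat) : set Omega := [set w |
  (((t < W (K0 + k%:Z) 0%N w /\ arr i n w <= t) /\ zeta (arr i n w) w i = u) /\
  ~ arr i n.+1 w <= t)].
have dstep k n : det (step k n).
  apply: determined_and; last by apply: determined_not; exact: determined_arrival.
  have [p ->] := iK k; exact: determined_state_at_ring.
have := @determined_exists _ _ (fun k : nat * nat => dstep k.1 k.2).
apply: determined_ae; apply: filterS (regular_ae ips t0) => w reg c /=.
split=> [zt|[[k n] /= [[[_ n1] z] /negP]]].
  have [k silent] := regular_silent reg K0.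
  have [n [/(_ n (leqnn n)) n1 n2]] :=
    @clock_at_exists _ _ _ _ W t i w t0 (regular_unbounded reg i).
  exists (k, n); rewrite /step/=; split; last by apply/negP; rewrite -ltNge.
  by split=> //; rewrite -(state_between_rings reg n1 n2).
by rewrite -ltNge => n2; rewrite (state_between_rings reg n1 n2).
Qed.

End fixed.
End traces.

(** * Lack of memory *)

(** Used to let the mesh of a discretisation tend to [0]. *)
Lemma le_of_expR {R : realType} (x y : R) : 0 <= y ->
  (forall e, 0 < e -> x <= expR e * y) -> x <= y.
Proof.
move=> y0 h; apply/ler_addgt0Pr => e e0.
have y1 : 0 < y + 1 by rewrite ltr_wpDl.
have d0 : 0 < e / (y + 1) by rewrite divr_gt0.
have := h (ln (1 + e / (y + 1))); rewrite ln_gt0 ?ltrDl// => /(_ isT).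
rewrite lnK; last by rewrite posrE addr_gt0.
move=> /le_trans; apply.
rewrite mulrDl mul1r lerD2l mulrAC -mulrA ler_piMr//; first exact: ltW.
by rewrite ler_pdivrMr// mul1r lerDl.
Qed.

Lemma measure_ae_eq {d} {T : measurableType d} {R : realType}
    (mu : {measure set T -> \bar R}) (A B : set T) :
  measurable A -> measurable B -> {ae mu, forall x, A x <-> B x} -> mu A = mu B.
Proof.
move=> mA mB [N [mN N0 AB]].
have sub (C D : set T) : measurable C -> measurable D ->
    (forall x, ~ N x -> C x -> D x) -> (mu C <= mu D)%E.
  move=> mC mD CD; apply: (@le_trans _ _ (mu (D `|` N))).
    apply: le_measure; rewrite ?inE//; first exact: measurableU.
    by move=> x Cx; have [Nx|Nx] := pselect (N x); [right|left; exact: CD].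
  apply: le_trans (measureU2 _ _ _) _ => //.
  by rewrite [X in (_ + X)%E](_ : _ = 0%E)// adde0.
have N' x : ~ N x -> (A x <-> B x) by move=> nN; have [//|/AB] := pselect (A x <-> B x).
apply/eqP; rewrite eq_le; apply/andP; split; apply: sub => // x /N' [].
  by [].
by [].
Qed.

Section rings.
Context {R : realType} {P : bool -> bool -> bool -> R}.
Context {d} {Omega : measurableType d} {Pr : probability Omega R}.
Variables (W U : int -> nat -> {RV Pr >-> R}) (zeta : R -> Omega -> config).
Hypothesis ips : is_IPS P W U zeta.

Local Notation arr := (arrival W).
Local Notation source := (source_events W U zeta).
Local Notation events X := (events_of source X).

Lemma eventsI X A B : events X A -> events X B -> events X (A `&` B).
Proof.
exact: (@measurableI _ (g_sigma_algebraType (\bigcup_(i in X) source i))).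
Qed.

Lemma events_arrival X j n (B : set R) :
  (forall k, (k < n)%N -> X (waiting_index j k)) -> measurable B ->
  events X (arr j n @^-1` B).
Proof.
move=> Xj mB.
suff : measurable_fun setT
    (arr j n : g_sigma_algebraType (\bigcup_(i in X) source i) -> R).
  by move=> /(_ measurableT B mB); rewrite setTI.
elim: n Xj => [|n ih] Xj.
  rewrite (_ : (arr j 0%N : _ -> R) = cst 0); first exact: measurable_cst.
  by apply/funext => w; rewrite arrival0.
rewrite (_ : (arr j n.+1 : _ -> R) = (fun w => arr j n w + W j n w)); last first.
  by apply/funext => w; rewrite arrivalS.
apply: measurable_funD; first by apply: ih => k kn; apply: Xj; exact: ltnW.
move=> _ C mC; rewrite setTI; apply: (@events_of_sub _ _ _ _ X _ _ (Xj n (leqnn _))).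
by exists C => //; rewrite setTI.
Qed.

Lemma measurable_events X A : events X A -> measurable A.
Proof. by apply: events_of_measurable; exact: source_events_measurable ips. Qed.

Lemma events_clock_le X j t n :
  (forall k, (k < n)%N -> X (waiting_index j k)) ->
  events X [set w | forall m, (m <= n)%N -> arr j m w <= t].
Proof.
move=> Xj.
have -> : [set w | forall m, (m <= n)%N -> arr j m w <= t] =
    \bigcap_(m in [set m | (m <= n)%N]) (arr j m @^-1` `]-oo, t]).
  apply/seteqP; split => w h m /= mn; last have := h m mn; rewrite /= ?in_itv//=.
  exact: h.
apply: (@bigcap_measurable _ (g_sigma_algebraType (\bigcup_(i in X) source i))).
  by exists 0%N.
by move=> m mn; apply: events_arrival => // k km; apply: Xj; exact: leq_trans mn.
Qed.

Lemma events_clock_at X j t n :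
  (forall k, (k <= n)%N -> X (waiting_index j k)) ->
  events X (clock_at W t j n).
Proof.
move=> Xj.
have -> : clock_at W t j n = [set w | forall m, (m <= n)%N -> arr j m w <= t]
    `&` arr j n.+1 @^-1` `]t, +oo[.
  by apply/seteqP; split => w [h1 h2]; split=> //; move: h2; rewrite /= in_itv/= andbT.
apply: eventsI.
  by apply: events_clock_le => k kn; apply: Xj; exact: ltnW.
by apply: events_arrival.
Qed.

Lemma measurable_arrival j n (B : set R) : measurable B ->
  measurable (arr j n @^-1` B).
Proof. by move=> mB; apply: (@measurable_events setT); exact: events_arrival. Qed.

Lemma measurable_clock_at t j n : measurable (clock_at W t j n).
Proof. by apply: (@measurable_events setT); exact: events_clock_at. Qed.

Section memoryless.
Variables (t : R) (j : int) (n : nat) (E : set Omega).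
Hypothesis oE : events (others j n) E.
Hypothesis Et : forall w, E w -> arr j n w <= t.

Let phi (s : R) : set Omega := E `&` arr j n.+1 @^-1` `]t + s, +oo[.

Let mphi s : measurable (phi s).
Proof.
apply: measurableI; [exact: measurable_events oE|exact: measurable_arrival].
Qed.

Let slice (e : R) (k : nat) : set Omega :=
  E `&` arr j n @^-1` `]t - k.+1%:R * e, t - k%:R * e].

Let slice_events e k : events (others j n) (slice e k).
Proof.
apply: eventsI => //; apply: events_arrival => // m mn.
by split=> // -[e']; rewrite e' ltnn in mn.
Qed.

Let slice_wait e k x : 0 <= x ->
  Pr (slice e k `&` [set w | x < W j n w]) = (Pr (slice e k) * (expR (- x))%:E)%E.
Proof.
move=> x0; rewrite -(waiting_time_tail ips j n x0).
apply: (independent_source ips (i := waiting_index j n)) (slice_events e k) _.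
  by move=> [].
exists `]x, +oo[%classic => //; rewrite setTI.
by apply/seteqP; split => w /=; rewrite in_itv/= andbT.
Qed.

Let slice_cover e : 0 < e -> E = \bigcup_k slice e k.
Proof.
move=> e0; apply/seteqP; split => [w Ew|w [k _ []]//].
have h : 0 <= (t - arr j n w) / e by rewrite divr_ge0 ?subr_ge0 ?Et// ltW.
exists (Num.truncn ((t - arr j n w) / e)) => //; split=> //=.
rewrite in_itv/=; have /andP[] := truncn_itv h.
rewrite ler_pdivlMr// ltr_pdivrMr// => h1 h2.
by apply/andP; split; lra.
Qed.

Let slice_disjoint e (G : set Omega) : 0 < e ->
  trivIset setT (fun k => slice e k `&` G).
Proof.
move=> e0; apply/trivIsetP => a b _ _ ab; apply/seteqP; split => // w [[[_ ha] _] [[_ hb] _]].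
move: ha hb; rewrite /= !in_itv/= => /andP[a1 a2] /andP[b1 b2].
case/negP: ab; rewrite eqn_leq; apply/andP.
by split; rewrite -ltnS -(ltr_nat R) -(ltr_pM2r e0); lra.
Qed.

Let phi_sum e s : 0 < e ->
  Pr (phi s) = (\sum_(0 <= k <oo) Pr (slice e k `&` arr j n.+1 @^-1` `](t + s)%R, +oo[%classic))%E.
Proof.
move=> e0; rewrite /phi (slice_cover e0) setI_bigcupl measure_bigcup//=.
- by apply: eq_eseriesl => k; rewrite in_setT.
- move=> k _; apply: measurableI; last exact: measurable_arrival.
  exact: measurable_events (slice_events e k).
- exact: slice_disjoint.
Qed.

Let phi_le e s s' : 0 < e -> 0 <= s -> 0 <= s' ->
  (Pr (phi s) <= (expR (e + s' - s))%:E * Pr (phi s'))%E.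
Proof.
move=> e0 s0 s'0; rewrite !(phi_sum _ e0) -nneseriesZl//.
apply: lee_nneseries => // k _.
have mwait x : measurable [set w | x < W j n w].
  rewrite (_ : mkset _ = W j n @^-1` `]x, +oo[); first exact: measurable_funPTI.
  by apply/seteqP; split => w /=; rewrite in_itv/= andbT.
have mslice := measurable_events (slice_events e k).
have k0 : 0 <= k%:R * e by rewrite mulr_ge0// ltW.
have k1 : 0 <= k.+1%:R * e by rewrite mulr_ge0// ltW.
apply: (@le_trans _ _ (Pr (slice e k `&` [set w | k%:R * e + s < W j n w]))).
  apply: le_measure; rewrite ?inE.
  - by apply: measurableI => //; exact: measurable_arrival.
  - exact: measurableI.
  - move=> w [Sw]; rewrite /= in_itv/= andbT arrivalS => h; split=> //=.
    by case: Sw => _; rewrite /= in_itv/= => /andP[_]; lra.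
apply: (@le_trans _ _ ((expR (e + s' - s))%:E *
   Pr (slice e k `&` [set w | (k.+1%:R * e + s' < W j n w)%R]))%E).
  rewrite !slice_wait ?addr_ge0// muleCA -EFinM -expRD.
  rewrite (_ : e + s' - s - (k.+1%:R * e + s') = - (k%:R * e + s))//.
  by rewrite -natr1; ring.
apply: lee_wpmul2l; first by rewrite lee_fin expR_ge0.
apply: le_measure; rewrite ?inE.
- exact: measurableI.
- by apply: measurableI => //; exact: measurable_arrival.
- move=> w [Sw] /= h; split=> //=; rewrite in_itv/= andbT arrivalS.
  by case: Sw => _; rewrite /= in_itv/= => /andP[]; lra.
Qed.

(** Cut [E] into slices on which the last arrival [arr j n] is known up to [e]. On
a slice, having no further ring by [t + s] lies between two events on the next
waiting time, which is independent of the slice, and replacing [s] by [s']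
changes the probability by the factor [exp(s' - s)] up to [exp e]. *)
Lemma memoryless s : 0 <= s -> Pr (E `&` arr j n.+1 @^-1` `]t + s, +oo[) =
  ((expR (- s))%:E * Pr (E `&` arr j n.+1 @^-1` `]t, +oo[))%E.
Proof.
move=> s0.
have -> : E `&` arr j n.+1 @^-1` `]t, +oo[ = phi 0 by rewrite /phi addr0.
rewrite -/(phi s).
have f0 : Pr (phi 0) \is a fin_num by rewrite fin_num_measure.
have fs : Pr (phi s) \is a fin_num by rewrite fin_num_measure.
have p0 : 0 <= fine (Pr (phi 0)) by rewrite fine_ge0.
have ps : 0 <= fine (Pr (phi s)) by rewrite fine_ge0.
have le0 e := @phi_le e s 0; have le1 e := @phi_le e 0 s.
rewrite -(fineK f0) -(fineK fs) -EFinM; congr EFin.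
apply/eqP; rewrite eq_le; apply/andP; split.
  apply: le_of_expR => [|e e0]; first by rewrite mulr_ge0 ?expR_ge0.
  have := le0 e e0 s0 (lexx _); rewrite -(fineK f0) -(fineK fs) -EFinM lee_fin.
  by rewrite addr0 expRD mulrA.
apply: le_of_expR => // e e0.
have := le1 e e0 (lexx _) s0; rewrite -(fineK f0) -(fineK fs) -EFinM lee_fin.
rewrite subr0 expRD => h.
rewrite -(ler_pM2l (expR_gt0 s)) mulrA -expRD subrr expR0 mul1r.
by apply: le_trans h _; rewrite [expR e * _]mulrC mulrA.
Qed.

End memoryless.
End rings.

(** * Probabilities of the next rings *)

Section ring_probabilities.
Context {R : realType} {P : bool -> bool -> bool -> R}.
Context {d} {Omega : measurableType d} {Pr : probability Omega R}.
Variables (W U : int -> nat -> {RV Pr >-> R}) (zeta : R -> Omega -> config).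
Hypothesis ips : is_IPS P W U zeta.

Local Notation arr := (arrival W).
Local Notation source := (source_events W U zeta).

Definition next_ring (t h : R) (j : int) (n : nat) : set Omega :=
  [set w | clock_at W t j n w /\ arr j n.+1 w <= t + h].

Definition rings (t h : R) (j : int) : set Omega :=
  \bigcup_n next_ring t h j n.

Lemma next_ring_events X t h j n :
  (forall k, (k <= n)%N -> X (waiting_index j k)) ->
  events_of source X (next_ring t h j n).
Proof.
move=> Xj.
have -> : next_ring t h j n = clock_at W t j n `&` arr j n.+1 @^-1` `]-oo, t + h].
  by apply/seteqP; split => w []; rewrite /= ?in_itv//=; split=> //; rewrite in_itv.
apply: eventsI; first exact: events_clock_at.
by apply: events_arrival.
Qed.

Lemma rings_events X t h j :
  (forall k, X (waiting_index j k)) -> events_of source X (rings t h j).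
Proof.
move=> Xj.
apply: (@bigcupT_measurable _ (g_sigma_algebraType (\bigcup_(i in X) source i))).
by move=> n; exact: next_ring_events.
Qed.

Lemma measurable_next_ring t h j n : measurable (next_ring t h j n).
Proof.
by apply: (measurable_events ips (X := setT)); exact: next_ring_events.
Qed.

Lemma measurable_rings t h j : measurable (rings t h j).
Proof. by apply: (measurable_events ips (X := setT)); exact: rings_events. Qed.

Lemma sum_over_clock t j (C D : nat -> set Omega) (q : R) :
  (forall n, measurable (C n)) -> (forall n, measurable (D n)) ->
  (forall n, C n `<=` clock_at W t j n) -> (forall n, D n `<=` clock_at W t j n) ->
  0 <= q -> (forall n, Pr (C n) = (q%:E * Pr (D n))%E) ->
  Pr (\bigcup_n C n) = (q%:E * Pr (\bigcup_n D n))%E.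
Proof.
move=> mC mD cC cD q0 CD.
have triv (F : nat -> set Omega) : (forall n, F n `<=` clock_at W t j n) ->
    trivIset setT F.
  move=> cF; apply/trivIsetP => a b _ _ ab; apply/seteqP; split => // w [Fa Fb].
  by move: ab; rewrite (clock_at_unique (cF _ _ Fa) (cF _ _ Fb)) eqxx.
rewrite !measure_bigcup//=; try exact: triv.
by rewrite -nneseriesZl//; apply: eq_eseriesr => n _.
Qed.

Lemma clock_at_cover t j : 0 <= t ->
  {ae Pr, forall w, (\bigcup_n clock_at W t j n) w}.
Proof.
move=> t0; apply: filterS (arrival_unbounded ips t0) => w /(_ j) /(clock_at_exists t0).
by move=> [n cn]; exists n.
Qed.

Section from_time.
Variables (t h : R).
Hypotheses (t0 : 0 <= t) (h0 : 0 <= h).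

(** On [clock_at] the event [A] agrees with an event of the other sources, to which
the lack of memory applies. *)
Lemma next_ring_prob j n A : measurable A -> determined W U zeta t j n A ->
  Pr (A `&` next_ring t h j n) =
    ((1 - expR (- h))%:E * Pr (A `&` clock_at W t j n))%E.
Proof.
move=> mA [B eB AB].
have mB := measurable_events ips eB.
pose E := B `&` [set w | forall m, (m <= n)%N -> arr j m w <= t].
have eE : events_of source (others j n) E.
  apply: eventsI => //; apply: events_clock_le => k kn.
  by split=> // -[e]; rewrite e ltnn in kn.
have Et w : E w -> arr j n w <= t by move=> [_]; apply.
have ml := memoryless ips eE Et h0.
have mE := measurable_events ips eE.
have mtail s : measurable (E `&` arr j n.+1 @^-1` `]s, +oo[).
  by apply: measurableI => //; exact: (measurable_arrival ips).
have -> : Pr (A `&` clock_at W t j n) = Pr (E `&` arr j n.+1 @^-1` `]t, +oo[).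
  apply: measure_ae_eq => //.
    by apply: measurableI => //; exact: (measurable_clock_at ips).
  apply: filterS AB => w h1; split.
    move=> [Aw cw]; have [c1 c2] := cw; split; first by split=> //; apply/h1.
    by rewrite /= in_itv/= andbT.
  move=> [[Bw c1]]; rewrite /= in_itv/= andbT => c2.
  have cw : clock_at W t j n w by [].
  by split=> //; apply/h1.
have -> : Pr (A `&` next_ring t h j n) =
   Pr ((E `&` arr j n.+1 @^-1` `]t, +oo[) `\` (E `&` arr j n.+1 @^-1` `]t + h, +oo[)).
  apply: measure_ae_eq.
  - by apply: measurableI => //; exact: measurable_next_ring.
  - exact: measurableD.
  - apply: filterS AB => w h1; split.
      move=> [Aw [cw r]]; have [c1 c2] := cw; split.
        by split; [split=> //; apply/h1|rewrite /= in_itv/= andbT].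
      by move=> [_]; rewrite /= in_itv/= andbT ltNge r.
    move=> [[[Bw c1]]]; rewrite /= in_itv/= andbT => c2 nr.
    have cw : clock_at W t j n w by [].
    split; [by apply/h1|split=> //].
    rewrite leNgt; apply/negP => r; apply: nr; split => //.
    by rewrite /= in_itv/= andbT.
have sub : E `&` arr j n.+1 @^-1` `]t + h, +oo[ `<=` E `&` arr j n.+1 @^-1` `]t, +oo[.
  apply: setIS => w; rewrite /= !in_itv/= !andbT => r.
  by rewrite (le_lt_trans _ r)// lerDl.
set Y := E `&` arr j n.+1 @^-1` `]t, +oo[ in ml sub *.
set Z := E `&` _ in ml sub *.
have -> : Pr (Y `\` Z) = (Pr Y - Pr Z)%E.
  rewrite measureD ?setIidr//; [exact: mtail|exact: mtail|].
  by rewrite -ge0_fin_numE ?fin_num_measure//; exact: mtail.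
have /fineK fY : Pr Y \is a fin_num by rewrite fin_num_measure//; exact: mtail.
rewrite ml -fY -EFinM -EFinB -EFinM; congr EFin; ring.
Qed.

(** Sum over the number of rings by time [t]. *)
Lemma rings_prob j A : measurable A ->
  (forall n, determined W U zeta t j n A) ->
  Pr (A `&` rings t h j) = ((1 - expR (- h))%:E * Pr A)%E.
Proof.
move=> mA dA.
have -> : Pr A = Pr (\bigcup_n (A `&` clock_at W t j n)).
  rewrite -setI_bigcupr; apply: measure_ae_eq => //.
    apply: measurableI => //; apply: bigcupT_measurable => n.
    exact: (measurable_clock_at ips).
  by apply: filterS (clock_at_cover j t0) => w c; split=> [|[]].
rewrite /rings setI_bigcupr; apply: (@sum_over_clock t j).
- by move=> n; apply: measurableI => //; exact: measurable_next_ring.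
- by move=> n; apply: measurableI => //; exact: (measurable_clock_at ips).
- by move=> n w [_ []].
- by move=> n w [].
- by rewrite subr_ge0 -expR0 ler_expR oppr_le0.
- by move=> n; exact: next_ring_prob.
Qed.

Definition update_below (j : int) (p : R) : set Omega :=
  \bigcup_n (next_ring t h j n `&` [set w | U j n w < p]).

Let measurable_lt (X : {RV Pr >-> R}) (p : R) : measurable [set w | X w < p].
Proof.
rewrite (_ : mkset _ = X @^-1` `]-oo, p[); first exact: measurable_funPTI.
by apply/seteqP; split => w /=; rewrite in_itv.
Qed.

Lemma measurable_update_below j p : measurable (update_below j p).
Proof.
apply: bigcupT_measurable => n; apply: measurableI => //.
exact: measurable_next_ring.
Qed.

Lemma update_below_prob j p A : measurable A ->
  (forall n, determined W U zeta t j n A) -> 0 <= p <= 1 ->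
  Pr (A `&` update_below j p) = ((p * (1 - expR (- h)))%:E * Pr A)%E.
Proof.
move=> mA dA p01; have /andP[p0 _] := p01.
rewrite EFinM -muleA -(rings_prob mA dA) /rings setI_bigcupr.
rewrite /update_below setI_bigcupr; apply: (@sum_over_clock t j) => //.
- move=> n; apply: measurableI => //; apply: measurableI => //.
  exact: measurable_next_ring.
- by move=> n; apply: measurableI => //; exact: measurable_next_ring.
- by move=> n w [_ [[]]].
- by move=> n w [_ []].
move=> n; have [B eB AB] := dA n.
have mB := measurable_events ips eB.
pose X := [set i | i <> update_index j n] : set ips_index.
have eX : events_of source X (B `&` next_ring t h j n).
  apply: eventsI; last by apply: next_ring_events.
  by apply: events_of_mono eB => i [].
have -> : Pr (A `&` next_ring t h j n) = Pr (B `&` next_ring t h j n).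
  apply: measure_ae_eq.
  - by apply: measurableI => //; exact: measurable_next_ring.
  - by apply: measurableI => //; exact: measurable_next_ring.
  - by apply: filterS AB => w h1; split=> -[Aw r]; split=> //; apply/h1 => //;
      case: r.
have -> : Pr (A `&` (next_ring t h j n `&` [set w | U j n w < p])) =
    Pr ((B `&` next_ring t h j n) `&` [set w | U j n w < p]).
  apply: measure_ae_eq.
  - by apply: measurableI => //; apply: measurableI => //; exact: measurable_next_ring.
  - by apply: measurableI => //; apply: measurableI => //; exact: measurable_next_ring.
  - apply: filterS AB => w h1; split.
      by move=> [Aw [r u]]; split=> //; split=> //; apply/h1 => //; case: r.
    by move=> [[Bw r] u]; split=> //; apply/h1 => //; case: r.
rewrite (independent_source ips (i := update_index j n) _ eX).
- by rewrite muleC; congr (_ * _)%E; exact: update_prob ips _ _ _ p01.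
- by apply.
- exists `]-oo, p[%classic => //; rewrite setTI.
  by apply/seteqP; split => w /=; rewrite in_itv.
Qed.

Lemma rings_prob_le j : (Pr (rings t h j) <= h%:E)%E.
Proof.
rewrite -[X in Pr X]setTI rings_prob//; last first.
  by move=> n; exists setT; [exact: (@measurableT _ (g_sigma_algebraType _))|exact: aeW].
rewrite probability_setT mule1 lee_fin lerBlDr.
by have := expR_ge1Dx (- h); lra.
Qed.

Lemma double_ring_prob i j : i <> j ->
  (Pr (rings t h i `&` rings t h j) <= (h ^+ 2)%:E)%E.
Proof.
move=> ij; rewrite rings_prob//; last 2 first.
- exact: measurable_rings.
- move=> n; exists (rings t h i); last exact: aeW.
  by apply: rings_events => k; split=> // -[].
rewrite expr2 EFinM; apply: lee_pmul => //; last exact: rings_prob_le.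
  by rewrite lee_fin subr_ge0 -expR0 ler_expR oppr_le0.
by rewrite lee_fin; have := expR_ge1Dx (- h); lra.
Qed.

(** Two rings at [j] within [h] of each other: the next waiting time after the
first ring in the interval is at most [h]. *)
Definition rings_again (j : int) : set Omega :=
  \bigcup_n (next_ring t h j n `&` [set w | W j n.+1 w <= h]).

Let measurable_short j n : measurable [set w | W j n w <= h].
Proof.
rewrite (_ : mkset _ = W j n @^-1` `]-oo, h]); first exact: measurable_funPTI.
by apply/seteqP; split => w /=; rewrite in_itv.
Qed.

Lemma measurable_rings_again j : measurable (rings_again j).
Proof.
apply: bigcupT_measurable => n; apply: measurableI => //.
exact: measurable_next_ring.
Qed.

Lemma rings_again_prob j : (Pr (rings_again j) <= (h ^+ 2)%:E)%E.
Proof.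
have hh : 1 - expR (- h) <= h by have := expR_ge1Dx (- h); lra.
have -> : Pr (rings_again j) = ((1 - expR (- h))%:E * Pr (rings t h j))%E.
  apply: (@sum_over_clock t j) => //.
  - move=> n; apply: measurableI => //; exact: measurable_next_ring.
  - by move=> n; exact: measurable_next_ring.
  - by move=> n w [[]].
  - by move=> n w [].
  - by rewrite subr_ge0 -expR0 ler_expR oppr_le0.
  move=> n.
  pose X := [set i | i <> waiting_index j n.+1] : set ips_index.
  have eX : events_of source X (next_ring t h j n).
    by apply: next_ring_events => k kn -[e]; rewrite e ltnn in kn.
  rewrite (independent_source ips (i := waiting_index j n.+1) _ eX).
  - rewrite muleC; congr (_ * _)%E.
    have -> : [set w | W j n.+1 w <= h] = ~` [set w | h < W j n.+1 w].
      apply/seteqP; split => w /=; first by rewrite leNgt => /negP.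
      by move=> /negP; rewrite -leNgt.
    rewrite probability_setC; last first.
      rewrite (_ : mkset _ = W j n.+1 @^-1` `]h, +oo[); first exact: measurable_funPTI.
      by apply/seteqP; split => w /=; rewrite in_itv/= andbT.
    by rewrite EFinB; congr (_ - _)%E; exact: waiting_time_tail ips _ _ _ h0.
  - by apply.
  - exists `]-oo, h]%classic => //; rewrite setTI.
    by apply/seteqP; split => w /=; rewrite in_itv.
rewrite expr2 EFinM; apply: lee_pmul => //; last exact: rings_prob_le.
by rewrite lee_fin subr_ge0 -expR0 ler_expR oppr_le0.
Qed.

End from_time.
End ring_probabilities.

(** * The moment equation of the process *)

Section drift.
Context {R : realType} (P : bool -> bool -> bool -> R) (m : R).
Hypothesis hsym : P true true false = P true false true.

Definition drift_of : ({fset int} -> R) -> {fset int} -> int -> R :=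
  site_drift (P true false false) (P true true false) (P true true true) m.

(** The generator at [j] applied to a monomial. *)
Lemma site_drift_monomial (S : {fset int}) j (x : config) : j \in S ->
  drift_of (fun T => monomial m T x) S j =
    (P true (x j) (x (j + 1)) - (x j)%:R) * monomial m (S `\ j)%fset x.
Proof.
move=> jS; rewrite /drift_of /site_drift.
have nj : j + 1 != j by rewrite -subr_eq0 addrAC subrr add0r.
rewrite (monomialD1 _ _ jS).
set b := P true true false; set a := P true false false; set c := P true true true.
have pE : P true (x j) (x (j + 1)) = a + (b - a) * ((x j)%:R + (x (j + 1))%:R)
    + quad a b c * ((x j)%:R * (x (j + 1))%:R).
  rewrite /quad /a /b /c; case: (x j); case: (x (j + 1)); rewrite -?hsym;
    rewrite ?mulr1n ?mulr0n; ring.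
case: ifPn => j1S.
  have j1S' : j + 1 \in (S `\ j)%fset by rewrite in_fsetD1 nj.
  have jS' : j \in (S `\ (j + 1)%R)%fset by rewrite in_fsetD1 eq_sym nj.
  have -> : (S `\ (j + 1)%R)%fset = (j |` (S `\ j `\ (j + 1)%R))%fset.
    have -> : (S `\ j `\ (j + 1)%R = S `\ (j + 1)%R `\ j)%fset.
      by rewrite !fsetDDl fsetUC.
    by rewrite fsetD1K.
  rewrite (monomialD1 _ _ j1S') monomialU1; last first.
    by rewrite !in_fsetD1 eqxx andbF.
  rewrite pE /slope /bias /quad.
  set M := monomial _ _ _.
  by case: (x j); case: (x (j + 1)); rewrite ?mulr1n ?mulr0n; ring.
have nj1 : j + 1 \notin (S `\ j)%fset by rewrite in_fsetD1 (negbTE j1S) andbF.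
rewrite (monomialU1 _ _ nj1) (monomialU1 _ _ j1S) (monomialD1 _ _ jS).
rewrite pE /slope /bias /quad.
set M := monomial _ _ _.
by case: (x j); case: (x (j + 1)); rewrite ?mulr1n ?mulr0n; ring.
Qed.

Lemma drift_mean {d} {T : measurableType d} (mu : probability T R)
    (F : {fset int} -> T -> R) S j : (forall U, bounded_measurable (F U)) ->
  mean mu (fun x => drift_of (fun U => F U x) S j) =
  drift_of (fun U => mean mu (F U)) S j.
Proof.
move=> bF; rewrite /drift_of /site_drift.
have bZ r U : bounded_measurable (fun x => r * F U x).
  exact: bounded_measurableZ.
case: ifPn => _.
  by rewrite meanB ?meanD ?meanZ//; repeat (apply: bounded_measurableD => //).
by rewrite meanB ?meanD ?meanZ//; repeat (apply: bounded_measurableD => //).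
Qed.

End drift.

Lemma measure_bigsetU_le {d} {T : measurableType d} {R : realType}
    (mu : {measure set T -> \bar R}) (I : Type) (s : seq I) (F : I -> set T) (c : R) :
  (forall i, measurable (F i)) -> (forall i, (mu (F i) <= c%:E)%E) ->
  (mu (\big[setU/set0]_(i <- s) F i) <= ((size s)%:R * c)%:E)%E.
Proof.
move=> mF Fc; elim: s => [|i s ih]; first by rewrite big_nil measure0 mul0r.
rewrite big_cons /= -add1n natrD mulrDl mul1r EFinD.
apply: le_trans (leeD (Fc i) ih); apply: measureU2 => //.
exact: bigsetU_measurable.
Qed.

Section one_step.
Context {R : realType} {P : bool -> bool -> bool -> R}.
Context {d} {Omega : measurableType d} {Pr : probability Omega R}.
Variables (W U : int -> nat -> {RV Pr >-> R}) (zeta : R -> Omega -> config).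
Hypothesis ips : is_IPS P W U zeta.
Hypothesis hP : transition_matrix P.
Hypothesis hsym : P true true false = P true false true.
Variable m : R.
Hypothesis m01 : 0 <= m <= 1.

Local Notation arr := (arrival W).

Definition moment (t : R) (S : {fset int}) : R :=
  mean Pr (fun w => monomial m S (zeta t w)).

Lemma transition_01 u v : 0 <= P true u v <= 1.
Proof. by have [p0 p1 p01] := hP u v; rewrite p1/= -p01 lerDr. Qed.

Lemma bounded_measurable_state t s (f : config -> R) : 0 <= t -> depends_on s f ->
  bounded_measurable (fun w => f (zeta t w)).
Proof.
move=> t0 df; have [mf [M fM]] := bounded_measurable_cylinder df; split.
  by apply: (measurableT_comp mf); exact: (IPS_measurable ips).
by exists M => w; exact: fM.
Qed.

Lemma measurable_state t j b : 0 <= t -> measurable [set w | zeta t w j = b].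
Proof.
move=> t0; have := IPS_measurable ips t0 measurableT (measurable_site j b).
by rewrite setTI.
Qed.

Lemma determinedT t j n : determined W U zeta t j n setT.
Proof.
by exists setT; [exact: (@measurableT _ (g_sigma_algebraType _))|exact: aeW].
Qed.

(** If [G] has conditional probability [q] given each determined event, it is
uncorrelated with each function of the state at time [t]; the auxiliary event
[A] makes the induction on the sites possible. *)
Lemma event_factor t j (G : set Omega) q : 0 <= t -> measurable G ->
  (forall A, measurable A -> (forall n, determined W U zeta t j n A) ->
     Pr (A `&` G) = (q%:E * Pr A)%E) ->
  forall s f, depends_on s f ->
  mean Pr (fun w => \1_G w * f (zeta t w)) = q * mean Pr (fun w => f (zeta t w)).
Proof.
move=> t0 mG hG s f df.
suff main s' f' A : depends_on s' f' -> measurable A ->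
    (forall n, determined W U zeta t j n A) ->
    mean Pr (fun w => \1_A w * (\1_G w * f' (zeta t w))) =
    q * mean Pr (fun w => \1_A w * f' (zeta t w)).
  have := main s f setT df measurableT (determinedT t j).
  under [X in mean _ X]eq_fun do rewrite indicT mul1r.
  by under [X in _ = _ * mean _ X]eq_fun do rewrite indicT mul1r.
elim: s' f' A {s f df} => [|i s ih] f A df mA dA.
  have fE x : f x = f point by exact: df.
  under [X in mean _ X]eq_fun do rewrite fE mulrA mulrC.
  under [X in _ = _ * mean _ X]eq_fun do rewrite fE mulrC.
  rewrite !meanZ; last 2 first.
  - exact: bounded_measurable_indic.
  - by apply: bounded_measurableM; exact: bounded_measurable_indic.
  rewrite mulrCA; congr (_ * _).
  rewrite (_ : (fun _ => _) = \1_(A `&` G)); last first.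
    by rewrite indicI.
  rewrite !mean_indic//; last exact: measurableI.
  rewrite [X in fine X](hG A mA dA) fineM//.
  by rewrite fin_num_measure.
pose A' b := A `&` [set w | zeta t w i = b].
have mA' b : measurable (A' b) by apply: measurableI => //; exact: measurable_state.
have dA' b n : determined W U zeta t j n (A' b).
  by apply: (determined_and (dA n)); exact: (determined_state ips).
have bi (B : set Omega) : measurable B -> bounded_measurable (\1_B : Omega -> R).
  exact: bounded_measurable_indic.
have split_state (g : Omega -> R) : (fun w => \1_A w * (g w * f (zeta t w))) =
   (fun w => \1_(A' true) w * (g w * f (set_site i true (zeta t w))) +
            \1_(A' false) w * (g w * f (set_site i false (zeta t w)))).
  apply/funext => w; rewrite (site_split i f) /A' !indicI /=.
  rewrite !indicE.
  have -> : (w \in [set w | zeta t w i = true]) = zeta t w i.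
    by apply/idP/idP; rewrite inE.
  have -> : (w \in [set w | zeta t w i = false]) = ~~ zeta t w i.
    by apply/idP/idP; rewrite inE /=; [move=> ->|move=> /negbTE].
  by case: (zeta t w i) => /=; ring.
have split1 : (fun w => \1_A w * f (zeta t w)) =
   (fun w => \1_(A' true) w * f (set_site i true (zeta t w)) +
            \1_(A' false) w * f (set_site i false (zeta t w))).
  have := split_state (fun=> 1).
  under eq_fun do rewrite mul1r.
  by under [X in _ = X]eq_fun do rewrite !mul1r.
have dfb b : depends_on s (f \o set_site i b) by exact: depends_on_set_site df.
have bf b := bounded_measurable_state t0 (dfb b).
rewrite split_state split1 !meanD; last 4 first.
- exact: bounded_measurableM (bi _ (mA' _)) (bf true).
- exact: bounded_measurableM (bi _ (mA' _)) (bf false).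
- exact: bounded_measurableM (bi _ (mA' _)) (bounded_measurableM (bi _ mG) (bf true)).
- exact: bounded_measurableM (bi _ (mA' _)) (bounded_measurableM (bi _ mG) (bf false)).
rewrite mulrDr; congr (_ + _).
- exact: (ih (f \o set_site i true)).
- exact: (ih (f \o set_site i false)).
Qed.

Section jumps.
Variables (t h : R).
Hypotheses (t0 : 0 <= t) (h0 : 0 <= h).

Local Notation rings := (rings W t h).
Local Notation update_below := (update_below W U t h).
Local Notation rings_again := (rings_again W t h).

Lemma update_below_sub j p : update_below j p `<=` rings j.
Proof. by move=> w [n _ [r _]]; exists n. Qed.

Lemma update_belowP j p n w : next_ring W t h j n w ->
  update_below j p w <-> U j n w < p.
Proof.
move=> rn; split=> [[k _ [rk]]|up]; last by exists n.
by rewrite (clock_at_unique rn.1 rk.1).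
Qed.

Lemma no_ring j w : @regular _ P _ _ _ W U zeta t w ->
  ~ rings j w -> zeta (t + h) w j = zeta t w j.
Proof.
move=> reg nr.
have [n cn] := clock_at_exists t0 (regular_unbounded reg j).
have [c1 c2] := cn; have n1 := c1 n (leqnn n).
have n2 : t + h < arr j n.+1 w.
  by rewrite ltNge; apply/negP => rn; apply: nr; exists n.
rewrite (state_between_rings reg _ n2); last by rewrite (le_trans n1)// lerDl.
by rewrite -(state_between_rings reg n1).
Qed.

(** The letters seen by the update are those at time [t], since neither [j] nor
[j + 1] rings between [t] and the update. *)
Lemma single_ring j n w : @regular _ P _ _ _ W U zeta t w ->
  next_ring W t h j n w -> ~ rings (j + 1) w -> ~ rings_again j w ->
  zeta (t + h) w j =
    (U j n w < P true (zeta t w j) (zeta t w (j + 1))).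
Proof.
move=> reg rn nr na; have [[c1 c2] c3] := rn.
have n1 := c1 n (leqnn n).
have [e [d1 d2]] := clock_at_exists t0 (regular_unbounded reg (j + 1)).
have e1 := d1 e (leqnn e).
have e2 : t + h < arr (j + 1) e.+1 w.
  by rewrite ltNge; apply/negP => re; apply: nr; exists e.
have n3 : t + h < arr j n.+2 w.
  rewrite arrivalS ltr_leD// leNgt; apply/negP => Wh; apply: na; exists n => //.
  by split=> //; exact: ltW.
rewrite (state_between_rings reg c3 n3).
rewrite (state_at_ring reg (le_lt_trans e1 c2)); last first.
  exact: le_trans c3 (ltW e2).
by rewrite -(state_between_rings reg n1 c2) -(state_between_rings reg e1 d2).
Qed.

Section jump_terms.
Variable S : {fset int}.

Definition configured (j : int) (u v : bool) (x : config) : R :=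
  ((x j == u) && (x (j + 1) == v))%:R * monomial m (S `\ j)%fset x.

Definition occupied (j : int) (x : config) : R :=
  (x j)%:R * monomial m (S `\ j)%fset x.

(** The change of the monomial when [j] is the only site that rings. Summing over
the pairs [u], [v] makes the threshold [P true u v] of the update a constant,
as required by [update_below_prob]. *)
Definition jump (j : int) (w : Omega) : R :=
  \sum_(u : bool) \sum_(v : bool)
     \1_(update_below j (P true u v)) w * configured j u v (zeta t w)
  - \1_(rings j) w * occupied j (zeta t w).

Definition neighbours : seq int := (S : seq int) ++ [seq j + 1 | j <- (S : seq int)].

(** Outside this event at most one site near [S] rings during the interval, and it
rings only once. *)
Definition exceptional : set Omega :=
  \big[setU/set0]_(k <- [seq (i, j) | i <- neighbours, j <- neighbours])
     (if k.1 == k.2 then set0 else rings k.1 `&` rings k.2)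
  `|` \big[setU/set0]_(j <- S) rings_again j.

Lemma exceptional_double i j w : i \in neighbours -> j \in neighbours ->
  i != j -> rings i w -> rings j w -> exceptional w.
Proof.
move=> iS jS ij ri rj; left; rewrite -bigcup_seq; exists (i, j) => /=.
  by apply/allpairsP; exists (i, j).
by rewrite (negbTE ij).
Qed.

Lemma exceptional_again j w : j \in S -> rings_again j w -> exceptional w.
Proof. by move=> jS rj; right; rewrite -bigcup_seq; exists j. Qed.

Lemma mem_neighbours j : j \in S -> j \in neighbours /\ j + 1 \in neighbours.
Proof.
move=> jS; rewrite !mem_cat jS; split=> //; apply/orP; right.
by apply/mapP; exists j.
Qed.

Lemma jump_no_ring j w : ~ rings j w -> jump j w = 0.
Proof.
move=> nr; rewrite /jump big1 => [|u _]; last first.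
  rewrite big1// => v _; rewrite indicE memNset ?mul0r//.
  by move/update_below_sub.
by rewrite indicE memNset// mul0r subr0.
Qed.

Lemma jump_ring j n w : next_ring W t h j n w -> jump j w =
  ((U j n w < P true (zeta t w j) (zeta t w (j + 1)))%R%:R - (zeta t w j)%:R)
   * monomial m (S `\ j)%fset (zeta t w).
Proof.
move=> rn.
have iE p : \1_(update_below j p) w = (U j n w < p)%R%:R :> R.
  rewrite indicE; congr (_%:R); congr nat_of_bool.
  by apply/idP/idP; rewrite inE => /(update_belowP p rn).
have rE : \1_(rings j) w = 1 :> R by rewrite indicE mem_set//; exists n.
rewrite /jump !big_bool /= !iE rE /configured /occupied.
by case: (zeta t w j); case: (zeta t w (j + 1)) => /=; ring.
Qed.

Lemma jump_decomposition w : @regular _ P _ _ _ W U zeta t w -> ~ exceptional w ->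
  monomial m S (zeta (t + h) w) - monomial m S (zeta t w)
    - \sum_(j <- S) jump j w = 0.
Proof.
move=> reg ne.
have [[j [jS [n _ rn]]]|nr] := pselect (exists j, j \in S /\ rings j w).
  have only i : i \in neighbours -> i != j -> ~ rings i w.
    move=> iS ij ri; apply: ne.
    by apply: (exceptional_double iS (mem_neighbours jS).1 ij ri); exists n.
  have others_same : monomial m (S `\ j)%fset (zeta (t + h) w) =
      monomial m (S `\ j)%fset (zeta t w).
    apply: depends_on_monomial => i; rewrite in_fsetD1 => /andP[ij iS].
    by apply: (no_ring reg); apply: only => //; exact: (mem_neighbours iS).1.
  rewrite !(monomialD1 _ _ jS) others_same (big_fsetD1 j)//=.
  rewrite (jump_ring rn) big_seq big1 ?addr0; last first.
    move=> i; rewrite in_fsetD1 => /andP[ij iS]; apply: jump_no_ring.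
    by apply: only => //; exact: (mem_neighbours iS).1.
  have j1 : ~ rings (j + 1) w.
    apply: only; first exact: (mem_neighbours jS).2.
    by rewrite -subr_eq0 addrAC subrr add0r.
  have ja : ~ rings_again j w by move/(exceptional_again jS).
  by rewrite (single_ring reg rn j1 ja); ring.
rewrite big_seq big1 => [|j jS]; last first.
  by apply: jump_no_ring => rj; apply: nr; exists j.
rewrite subr0 (@depends_on_monomial _ m S _ (zeta t w)) ?subrr// => j jS.
by apply: (no_ring reg) => rj; apply: nr; exists j.
Qed.

Lemma depends_on_configured j u v :
  depends_on (j :: j + 1 :: (S `\ j)%fset) (configured j u v).
Proof.
move=> x y xy; rewrite /configured (xy j) ?mem_head// (xy (j + 1)); last first.
  by rewrite !inE eqxx orbT.
by rewrite (@depends_on_monomial _ m _ x y)// => i iS; apply: xy; rewrite 2!in_cons iS !orbT.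
Qed.

Lemma depends_on_occupied j :
  depends_on (j :: (S `\ j)%fset) (occupied j).
Proof.
move=> x y xy; rewrite /occupied (xy j) ?mem_head//.
by rewrite (@depends_on_monomial _ m _ x y)// => i iS; apply: xy; rewrite in_cons iS orbT.
Qed.

Let b_conf j u v := bounded_measurable_state t0 (@depends_on_configured j u v).
Let b_occ j := bounded_measurable_state t0 (@depends_on_occupied j).
Let b_upd j p :=
  bounded_measurable_indic (R := R) (measurable_update_below ips t h j p).
Let b_rings j := bounded_measurable_indic (R := R) (measurable_rings ips t h j).

Lemma bounded_measurable_jump j : bounded_measurable (jump j).
Proof.
apply: bounded_measurableB; last exact: bounded_measurableM.
apply: bounded_measurable_sum => u; apply: bounded_measurable_sum => v.
exact: bounded_measurableM.
Qed.

Lemma mean_jump j : j \in S -> mean Pr (jump j) =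
  (1 - expR (- h)) * drift_of P m (moment t) S j.
Proof.
move=> jS.
rewrite /jump meanB; last 2 first.
- apply: bounded_measurable_sum => u; apply: bounded_measurable_sum => v; exact: bounded_measurableM.
- exact: bounded_measurableM.
rewrite mean_sum; last by move=> u; apply: bounded_measurable_sum => v; exact: bounded_measurableM.
have -> : mean Pr (fun w => \1_(rings j) w * occupied j (zeta t w)) =
   (1 - expR (- h)) * mean Pr (fun w => occupied j (zeta t w)).
  apply: (event_factor (j := j) t0 _ _ (@depends_on_occupied j)).
    exact: (measurable_rings ips).
  by move=> A mA dA; exact: (rings_prob ips).
have e1 u v : mean Pr (fun w => \1_(update_below j (P true u v)) w *
      configured j u v (zeta t w)) =
   P true u v * (1 - expR (- h)) * mean Pr (fun w => configured j u v (zeta t w)).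
  apply: (event_factor (j := j) t0 _ _ (@depends_on_configured j u v)).
    exact: (measurable_update_below ips).
  by move=> A mA dA; apply: (update_below_prob ips) => //; exact: transition_01.
under eq_bigr => u _.
  rewrite mean_sum; last by move=> v; exact: bounded_measurableM.
  under eq_bigr => v _ do rewrite e1 -mulrA mulrCA -meanZ//.
  rewrite -mulr_sumr -mean_sum; last by move=> v; exact: bounded_measurableZ.
  over.
rewrite -mulr_sumr -mean_sum; last first.
  by move=> u; apply: bounded_measurable_sum => v; exact: bounded_measurableZ.
rewrite -mulrBr -meanB//; last first.
  by apply: bounded_measurable_sum => u; apply: bounded_measurable_sum => v; exact: bounded_measurableZ.
congr (_ * _).
rewrite -(@drift_mean _ P m _ _ Pr (fun T w => monomial m T (zeta t w)) S j); last first.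
  by move=> T; exact: bounded_measurable_state (@depends_on_monomial _ m T).
congr (mean Pr _); apply/funext => w.
rewrite (site_drift_monomial m hsym _ jS) !big_bool /configured /occupied.
by case: (zeta t w j); case: (zeta t w (j + 1)) => /=; ring.
Qed.

Lemma measurable_exceptional : measurable exceptional.
Proof.
apply: measurableU; apply: bigsetU_measurable.
  move=> k _; case: ifPn => _; first exact: measurable0.
  by apply: measurableI; exact: (measurable_rings ips).
by move=> j _; exact: (measurable_rings_again ips).
Qed.

Lemma exceptional_prob : fine (Pr exceptional) <=
  (size neighbours * size neighbours + #|` S|)%:R * h ^+ 2.
Proof.
have mE := measurable_exceptional.
have h2 : 0 <= h ^+ 2 by rewrite exprn_ge0.
rewrite -lee_fin fineK ?fin_num_measure// natrD mulrDl EFinD.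
have m1 : measurable (\big[setU/set0]_(k <- [seq (i, j) | i <- neighbours, j <- neighbours])
     (if k.1 == k.2 then set0 else rings k.1 `&` rings k.2)).
  apply: bigsetU_measurable => k _; case: ifPn => _; first exact: measurable0.
  by apply: measurableI; exact: (measurable_rings ips).
have m2 : measurable (\big[setU/set0]_(j <- S) rings_again j).
  by apply: bigsetU_measurable => k _; exact: (measurable_rings_again ips).
apply: le_trans (measureU2 _ m1 m2) _.
apply: leeD.
  rewrite -(size_allpairs pair); apply: measure_bigsetU_le => [k|k].
    case: ifPn => _; first exact: measurable0.
    by apply: measurableI; exact: (measurable_rings ips).
  case: ifPn => [_|/eqP ij]; first by rewrite measure0.
  exact: (double_ring_prob ips t0 h0).
apply: measure_bigsetU_le => k; first exact: (measurable_rings_again ips).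
exact: (rings_again_prob ips).
Qed.

Lemma monomial_le1 T (x : config) : `|monomial m T x| <= 1.
Proof.
apply: le_trans (monomial_bound T x m01 erefl) _.
apply: exprn_ile1; first by case/andP: m01 => m0 _; rewrite le_max m0.
by rewrite ge_max; case/andP: m01 => ? ?; apply/andP; split; lra.
Qed.

Lemma jump_bounded j w : `|jump j w| <= 5.
Proof.
have term (b : bool) (c : bool) T (x : config) :
    `|b%:R * (c%:R * monomial m T x)| <= 1.
  rewrite !normrM !normr_nat mulrA.
  case: b; case: c; rewrite ?mul1r ?mul0r// ?ler01//; exact: monomial_le1.
rewrite /jump (_ : 5 = 1 + 1 + (1 + 1) + 1); last by ring.
apply: le_trans (ler_normB _ _) _.
apply: lerD; last by rewrite indicE; exact: term.
rewrite !big_bool /=.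
apply: le_trans (ler_normD _ _) _; apply: lerD;
  apply: le_trans (ler_normD _ _) _; apply: lerD; rewrite indicE; exact: term.
Qed.

Lemma drift_bounded j : j \in S -> `|drift_of P m (moment t) S j| <= 1.
Proof.
move=> jS.
have bm T := bounded_measurable_state t0 (@depends_on_monomial _ m T).
rewrite -(@drift_mean _ P m _ _ Pr (fun T w => monomial m T (zeta t w)) S j)//.
have eq w := site_drift_monomial m hsym (zeta t w) jS.
under [X in mean _ X]eq_fun do rewrite eq.
apply: mean_norm_le.
  apply: (@bounded_measurable_state t (j :: j + 1 :: (S `\ j)%fset)
    (fun x => (P true (x j) (x (j + 1)) - (x j)%:R) * monomial m (S `\ j)%fset x)) => //.
  move=> x y xy; rewrite (xy j) ?mem_head// (xy (j + 1)); last first.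
    by rewrite !inE eqxx orbT.
  by rewrite (@depends_on_monomial _ m _ x y)// => i iS; apply: xy; rewrite 2!in_cons iS !orbT.
move=> w; rewrite normrM mulr_ile1// ?monomial_le1//.
have /andP[p0 p1] := transition_01 (zeta t w j) (zeta t w (j + 1)).
by rewrite ler_norml; case: (zeta t w j) p0 p1 => /= p0 p1; apply/andP; split; lra.
Qed.

End jump_terms.
End jumps.

(** Off the exceptional event, of probability [O(h ^ 2)], the monomial changes by
the sum of the jumps. The expectation of a jump is [1 - exp(- h)] times the
drift, and [1 - exp(- h)] differs from [h] by at most [h ^ 2]. *)
Lemma moment_one_step :
  solves_moment_equation (P true false false) (P true true false)
    (P true true true) m moment.
Proof.
move=> S.
pose N := (size (neighbours S) * size (neighbours S) + #|` S|)%:R : R.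
pose M := 2 + 5 * #|` S|%:R : R.
exists (M * N + #|` S|%:R); first by rewrite addr_ge0 ?mulr_ge0 ?addr_ge0 ?mulr_ge0.
move=> t h t0 /andP[h0 h1].
pose D w := monomial m S (zeta (t + h) w) - monomial m S (zeta t w)
  - \sum_(j <- S) jump t h S j w.
have bm s : 0 <= s -> bounded_measurable (fun w => monomial m S (zeta s w)).
  by move=> s0; exact: bounded_measurable_state s0 (@depends_on_monomial _ m S).
have th0 : 0 <= t + h by rewrite addr_ge0.
have bj j : bounded_measurable (jump t h S j) by exact: bounded_measurable_jump.
have bD : bounded_measurable D.
  apply: bounded_measurableB; last exact: bounded_measurable_sum.
  by apply: bounded_measurableB; exact: bm.
have meanDE : mean Pr D = moment (t + h) S - moment t S -
    (1 - expR (- h)) * \sum_(j <- S) drift_of P m (moment t) S j.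
  rewrite /D meanB; last 2 first.
  - by apply: bounded_measurableB; exact: bm.
  - exact: bounded_measurable_sum.
  rewrite meanB; [|exact: bm|exact: bm].
  congr (_ - _); rewrite mean_sum// mulr_sumr big_seq [RHS]big_seq.
  by apply: eq_bigr => j jS; exact: mean_jump.
have sumS (F : int -> R) K : (forall j, j \in S -> `|F j| <= K) ->
    `|\sum_(j <- S) F j| <= #|` S|%:R * K.
  move=> FK; apply: le_trans (ler_norm_sum _ _ _) _.
  rewrite (_ : #|` S|%:R * K = \sum_(j <- S) K); last first.
    by rewrite big_const_seq count_predT iter_addr_0 mulr_natl.
  by rewrite big_seq [leRHS]big_seq; apply: ler_sum.
have DM w : `|D w| <= M.
  rewrite /D /M (_ : 2 = 1 + 1)//; apply: le_trans (ler_normB _ _) _.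
  apply: lerD.
    by apply: le_trans (ler_normB _ _) _; apply: lerD; exact: monomial_le1.
  by rewrite mulrC; apply: sumS => j _; exact: jump_bounded.
have D0 : {ae Pr, forall w, ~ exceptional t h S w -> D w = 0}.
  apply: filterS (regular_ae ips t0) => w reg ne.
  exact: (jump_decomposition t0 h0 reg ne).
have M0 : 0 <= M by rewrite addr_ge0// mulr_ge0.
have := mean_ae_le bD (measurable_exceptional t h S) M0 DM D0.
move=> /le_trans/(_ (ler_wpM2l M0 (exceptional_prob t0 h0 S))).
rewrite meanDE -/N => main.
have dS : `|\sum_(j <- S) drift_of P m (moment t) S j| <= #|` S|%:R.
  by rewrite -[leRHS]mulr1; apply: sumS => j jS; exact: drift_bounded.
rewrite -/(drift_of P m) in dS *.
set Sg := \sum_(j <- S) _ in main dS *.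
have eh : `|1 - expR (- h) - h| <= h ^+ 2.
  have e1 : 1 - h <= expR (- h) by rewrite expR_ge1Dx.
  have e2 : expR (- h) <= 1 - h + h ^+ 2.
    rewrite expRN -div1r ler_pdivrMr ?expR_gt0//.
    have e3 := expR_ge1Dx h.
    have : 0 <= 1 - h + h ^+ 2 by rewrite addr_ge0 ?subr_ge0 ?sqr_ge0.
    move=> /ler_wpM2l/(_ _ _ e3); apply: le_trans.
    rewrite (_ : (1 - h + h ^+ 2) * (1 + h) = 1 + h ^+ 3); last by ring.
    by rewrite lerDl exprn_ge0.
  by rewrite ler_norml; apply/andP; split; have := sqr_ge0 h; lra.
rewrite (_ : moment (t + h) S - moment t S - h * Sg =
  (moment (t + h) S - moment t S - (1 - expR (- h)) * Sg)
  + (1 - expR (- h) - h) * Sg); last by ring.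
apply: le_trans (ler_normD _ _) _; rewrite [leRHS]mulrDl.
apply: lerD; first by rewrite -mulrA.
by rewrite normrM mulrC; apply: ler_pM.
Qed.

End one_step.

(** * A probability measure with prescribed limits on cylinders *)

(** The enumeration 0, -1, 1, -2, 2, ... of the sites. *)
Definition nth_site (n : nat) : int :=
  if odd n then Negz n./2 else Posz n./2.

Definition site_index (j : int) : nat :=
  match j with Posz k => k.*2 | Negz k => k.*2.+1 end.

Lemma site_indexK : cancel site_index nth_site.
Proof.
by case=> k; rewrite /nth_site /= odd_double /= ?doubleK ?uphalf_double.
Qed.

Lemma nth_siteK : cancel nth_site site_index.
Proof.
move=> n; rewrite /nth_site -[RHS]odd_double_half.
by case: (odd n).
Qed.

(** The letters at the first [n] sites, latest first, so that words grow by
[cons]. *)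
Fixpoint prefix (x : config) (n : nat) : seq bool :=
  if n is k.+1 then x (nth_site k) :: prefix x k else [::].

Lemma prefix_eq x y n : prefix x n = prefix y n ->
  forall k, (k < n)%N -> x (nth_site k) = y (nth_site k).
Proof.
elim: n => //= n ih [xy /ih h] k; rewrite ltnS leq_eqVlt.
by move=> /predU1P[->|/h].
Qed.

Lemma eq_prefix x y n : (forall k, (k < n)%N -> x (nth_site k) = y (nth_site k)) ->
  prefix x n = prefix y n.
Proof.
elim: n => //= n ih h; rewrite h// ih// => k kn.
by apply: h; exact: ltnW.
Qed.

Definition word_cylinder (w : seq bool) : set config :=
  [set x | prefix x (size w) = w].

Lemma measurable_exists {d} {T : measurableType d} (K : countType)
    (A : K -> set T) : (forall k, measurable (A k)) ->
  measurable [set x | exists k, A k x].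
Proof.
move=> mA.
pose C n : set T := if @choice.unpickle K n is Some k then A k else set0.
rewrite (_ : mkset _ = \bigcup_n C n).
  apply: bigcupT_measurable => n; rewrite /C.
  by case: (@choice.unpickle K n).
apply/seteqP; split => x [k].
  by move=> Ak; exists (choice.pickle k) => //; rewrite /C choice.pickleK.
by rewrite /C; case: (@choice.unpickle K k) => [k' _|//]; exists k'.
Qed.

Section word_cylinders.
Context {R : realType}.

Lemma depends_on_word w :
  depends_on [seq nth_site k | k <- iota 0 (size w)]
    (\1_(word_cylinder w) : config -> R).
Proof.
move=> x y xy; rewrite !indicE; congr (_%:R); congr nat_of_bool.
have E : prefix x (size w) = prefix y (size w).
  by apply: eq_prefix => k kw; apply: xy; apply/map_f; rewrite mem_iota.
by apply/idP/idP; rewrite !inE /word_cylinder /= E.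
Qed.

Lemma measurable_word w : measurable (word_cylinder w).
Proof.
have [+ _] := bounded_measurable_cylinder (@depends_on_word w).
move=> /(_ measurableT [set 1] (measurable_set1 1)); rewrite setTI.
congr (measurable _); apply/seteqP; split => x /=; rewrite indicE.
  by case: (boolP (x \in _)) => [/set_mem//|_] /= /eqP; rewrite eq_sym oner_eq0.
by move=> xw; rewrite mem_set.
Qed.

Lemma indic_word_split w (x : config) : \1_(word_cylinder w) x =
  \1_(word_cylinder (false :: w)) x + \1_(word_cylinder (true :: w)) x :> R.
Proof.
rewrite !indicE.
have E b : (x \in word_cylinder (b :: w)) =
    (x (nth_site (size w)) == b) && (x \in word_cylinder w).
  apply/idP/andP; rewrite !inE /word_cylinder /=.
    by move=> [-> ->]; rewrite eqxx.
  by move=> [/eqP -> ->].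
rewrite !E; case: (x (nth_site _)) => /=; first by rewrite add0r.
by rewrite addr0.
Qed.

Section limit.
Variable mu_ : nat -> probability config R.
Hypothesis cvg_mu : forall s f, depends_on s f -> cvgn (fun n => mean (mu_ n) f).

Let p (w : seq bool) : R := limn (fun n => mean (mu_ n) (\1_(word_cylinder w))).

Let p_cvg w : mean (mu_ n) (\1_(word_cylinder w)) @[n --> \oo] --> p w.
Proof. exact: cvg_mu (@depends_on_word w). Qed.

Let p_ge0 w : 0 <= p w.
Proof.
apply: limr_ge; first exact: p_cvg.
by apply: nearW => n; apply: Rintegral_ge0 => x _; rewrite indicE.
Qed.

Let p_nil : p [::] = 1.
Proof.
apply/cvg_lim => //; rewrite (_ : (fun _ => _) = fun=> 1); first exact: cvg_cst.
apply/funext => n; rewrite (_ : \1_ _ = fun=> 1) ?mean_cst//.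
by apply/funext => x; rewrite indicE mem_set.
Qed.

Let p_split w : p w = p (false :: w) + p (true :: w).
Proof.
apply/cvg_lim => //.
rewrite (_ : (fun _ => _) = (fun n => mean (mu_ n) (\1_(word_cylinder (false :: w)))
   + mean (mu_ n) (\1_(word_cylinder (true :: w))))).
  by apply: cvgD; exact: p_cvg.
apply/funext => n; rewrite -meanD; last 2 first.
- by apply: bounded_measurable_indic; exact: measurable_word.
- by apply: bounded_measurable_indic; exact: measurable_word.
by congr (mean _ _); apply/funext => x; exact: indic_word_split.
Qed.

(** The word [w] is assigned the interval of length [p w] that starts at
[lower_end w]; the interval of [w] is the disjoint union of those of
[false :: w] and [true :: w], in this order. *)
Fixpoint lower_end (w : seq bool) : R :=
  if w is b :: v then lower_end v + (if b then p (false :: v) else 0) else 0.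

Let lower_end_bound w : 0 <= lower_end w /\ lower_end w + p w <= 1.
Proof.
elim: w => [|b w [h1 h2]] /=; first by rewrite p_nil add0r.
have := p_split w; have := p_ge0 (false :: w); have := p_ge0 (true :: w).
by case: b; rewrite ?addr0; split; lra.
Qed.

(** The word of length [n] whose interval contains [r]. *)
Fixpoint code (r : R) (n : nat) : seq bool :=
  if n is k.+1 then (lower_end (true :: code r k) <= r) :: code r k else [::].

Let code_itv r w : 0 <= r -> r < 1 ->
  code r (size w) = w <-> (lower_end w <= r /\ r < lower_end w + p w).
Proof.
move=> r0 r1; elim: w => [|b w ih] /=; first by rewrite p_nil add0r r0 r1.
have ps := p_split w; have pf := p_ge0 (false :: w); have pt := p_ge0 (true :: w).
split=> [[hb hw]|[h1 h2]].
  move: hb; rewrite hw; have [h1 h2] := ih.1 hw.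
  case: b => [h|/negbT]; first by split=> //; move: h; lra.
  by rewrite -ltNge => h; rewrite addr0; split=> //; lra.
have hw : code r (size w) = w.
  apply/ih; case: b h1 h2; rewrite ?addr0 => h1 h2; split; lra.
rewrite hw; congr cons; case: b h1 h2 => h1 h2; first exact: h1.
by apply/negbTE; rewrite -ltNge; move: h2; rewrite addr0.
Qed.

Let measurable_code n w : measurable [set r | code r n = w].
Proof.
elim: n w => [|n ih] [|b w] /=.
- by rewrite (_ : mkset _ = setT)//; apply/seteqP; split.
- by rewrite (_ : mkset _ = set0)//; apply/seteqP; split.
- by rewrite (_ : mkset _ = set0)//; apply/seteqP; split.
rewrite (_ : mkset _ = [set r | code r n = w] `&`
    (if b then `[lower_end (true :: w), +oo[%classic else `]-oo, lower_end (true :: w)[%classic)).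
  by apply: measurableI => //; case: b.
apply/seteqP; split => r /=.
  move=> [<- ->]; split=> //; case: ifPn => /=; rewrite in_itv/= ?andbT//.
  by rewrite -ltNge.
move=> [-> h]; congr cons; move: h; case: b => /=; rewrite in_itv/= ?andbT//.
by rewrite ltNge => /negbTE.
Qed.

Let decode (r : R) : config := fun j => head false (code r (site_index j).+1).

Let prefix_decode r n : prefix (decode r) n = code r n.
Proof. by elim: n => //= n ->; rewrite /decode nth_siteK. Qed.

Let measurable_decode : measurable_fun (setT : set (measurableTypeR R)) decode.
Proof.
apply: (@measurability _ _ (measurableTypeR R) config setT decode
  coordinate_sets erefl) => _ [_ [j [a ->]] <-].
rewrite setTI (_ : _ @^-1` _ = [set r | exists w,
    ([set r | code r (site_index j).+1 = w] `&` [set r | head false w = a]) r]).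
  apply: measurable_exists => w; apply: measurableI; first exact: measurable_code.
  have [h|h] := pselect (head false w = a).
    by rewrite (_ : mkset _ = setT)//; apply/seteqP; split => // x _; exact: h.
  by rewrite (_ : mkset _ = set0)//; apply/seteqP; split => // x /h.
apply/seteqP; split => r /=; first by exists (code r (site_index j).+1).
by move=> [w [<-]].
Qed.

Let decode_mfun : decode \in @mfun _ _ (measurableTypeR R) config.
Proof. by rewrite inE; exact: measurable_decode. Qed.

Let decode_rv : {mfun measurableTypeR R >-> config} :=
  @mfun_Sub _ _ (measurableTypeR R) config _ decode_mfun.

Let unif : probability (measurableTypeR R) R := uniform_prob (@ltr01 R).

Definition limit_measure : probability config R := distribution unif decode_rv.

Lemma limit_measure_word w : limit_measure (word_cylinder w) = (p w)%:E.
Proof.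
have [l0 l1] := lower_end_bound w; have pw := p_ge0 w.
pose L (x : R) : set (measurableTypeR R) := `]-oo, x[%classic.
have mL x : measurable (L x) by exact: measurable_itv.
have LE x r : L x r <-> r < x by rewrite /L /= in_itv.
have U x : 0 <= x <= 1 -> unif (L x) = x%:E by exact: uniform_prob_lt.
have lw1 : 0 <= lower_end w <= 1 by rewrite l0/=; lra.
have lw2 : 0 <= lower_end w + p w <= 1 by rewrite l1 andbT addr_ge0.
have -> : limit_measure (word_cylinder w) =
    unif (L (lower_end w + p w) `\` L (lower_end w)).
  rewrite (_ : limit_measure _ = unif [set r | code r (size w) = w]); last first.
    congr (unif _); apply/seteqP; split => r /=; rewrite /word_cylinder /=.
      by rewrite prefix_decode.
    by rewrite prefix_decode.
  apply: measure_ae_eq; [exact: measurable_code|exact: measurableD|].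
  have u0 : {ae unif, forall r, 0 <= r}.
    exists (L 0); split => //; first by rewrite U// lexx ler01.
    by move=> r /= /negP; rewrite -ltNge => /LE.
  have u1 : {ae unif, forall r, r < 1}.
    exists (~` L 1); split => //.
    - exact: measurableC.
    - by rewrite probability_setC// U ?lexx ?ler01// subee.
  have FF : Filter (nbhs (almost_everywhere unif)).
    exact: ae_filter_ringOfSetsType.
  apply: filterS2 u0 u1 => r r0 r1; have ci := code_itv w r0 r1.
  split=> [/ci[h1 h2]|[/LE h1 h2]].
    by split; [exact/LE|move/LE; rewrite ltNge h1].
  by apply/ci; split=> //; rewrite leNgt; apply/negP => h; apply/h2/LE.
have -> : unif (L (lower_end w + p w) `\` L (lower_end w)) =
    (unif (L (lower_end w + p w)%R) - unif (L (lower_end w)))%E.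
  rewrite measureD//; last by rewrite -ge0_fin_numE ?fin_num_measure.
  rewrite setIidr// => r /LE h; apply/LE.
  by rewrite (lt_le_trans h)// lerDl.
by rewrite !U// -EFinB; congr EFin; ring.
Qed.

(** A function of the first sites is constant on long words, and its mean over the
cylinder of a word is the sum of the means over its two extensions. *)
Lemma limit_measureP s f : depends_on s f ->
  mean (mu_ n) f @[n --> \oo] --> mean limit_measure f.
Proof.
move=> df.
pose K := (\max_(j <- s) (site_index j).+1)%N.
have df' x y : prefix x K = prefix y K -> f x = f y.
  move=> /prefix_eq xy; apply: df => j js.
  rewrite -(site_indexK j); apply: xy.
  by rewrite /K; apply: leq_bigmax_seq js isT.
have bf := bounded_measurable_cylinder df.
have bi w : bounded_measurable (\1_(word_cylinder w) : config -> R).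
  by apply: bounded_measurable_indic; exact: measurable_word.
suff main k w : (size w + k = K)%N ->
    mean (mu_ n) (fun x => \1_(word_cylinder w) x * f x) @[n --> \oo] -->
    mean limit_measure (fun x => \1_(word_cylinder w) x * f x).
  have := main K [::] erefl.
  rewrite (_ : (fun x => _ * f x) = f)//; apply/funext => x.
  by rewrite indicE mem_set// mul1r.
elim: k w => [|k ih] w.
  rewrite addn0 => wK.
  have [[x0 x0w]|nx] := pselect (exists x0, word_cylinder w x0).
    have E : (fun x => \1_(word_cylinder w) x * f x) =
        (fun x => f x0 * \1_(word_cylinder w) x).
      apply/funext => x; rewrite indicE.
      have [/set_mem xw|_] := boolP (x \in _); last by rewrite mul0r mulr0.
      by rewrite mul1r mulr1; apply: df'; rewrite -wK xw.
    rewrite E; under eq_fun do rewrite meanZ//.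
    rewrite meanZ//; apply: cvgMr.
    rewrite mean_indic; last exact: measurable_word.
    rewrite [X in fine X]limit_measure_word /=; exact: p_cvg.
  have E : (fun x => \1_(word_cylinder w) x * f x) = (fun=> 0).
    apply/funext => x; rewrite indicE memNset ?mul0r// => xw.
    by apply: nx; exists x.
  rewrite E mean_cst; under eq_fun do rewrite mean_cst.
  exact: cvg_cst.
rewrite addnS -addSn => wk.
have E : (fun x => \1_(word_cylinder w) x * f x) =
  (fun x => \1_(word_cylinder (false :: w)) x * f x
          + \1_(word_cylinder (true :: w)) x * f x).
  by apply/funext => x; rewrite indic_word_split mulrDl.
have bm b : bounded_measurable (fun x => \1_(word_cylinder (b :: w)) x * f x).
  exact: bounded_measurableM.
rewrite E; under eq_fun do rewrite meanD//.
by rewrite meanD//; apply: cvgD; exact: ih.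
Qed.

End limit.
End word_cylinders.

(** * Uniform approximation by cylinder functions *)

Section uniform_approximation.
Context {R : realType}.

Definition truncation (n : nat) (x : {ptws int -> bool}) : {ptws int -> bool} :=
  fun j => if (site_index j < n)%N then x j else false.

Lemma compact_configs : compact [set: {ptws int -> bool}].
Proof.
have := @tychonoff int (fun=> bool) (fun=> setT) (fun=> bool_compact).
by congr compact; apply/seteqP; split.
Qed.

(** Joint convergence in the configuration and in the length of the truncation; by
compactness it gives uniform approximation. *)
Lemma truncation_cvg (x : {ptws int -> bool}) :
  truncation p.2 p.1 @[p --> (x, \oo)] --> x.
Proof.
apply/cvg_sup => j A.
have /= -> := @nbhsE (initial_topology (@proj int (fun=> bool) j)) x.
case=> B [[C _ <-] Cx] /filterS; apply.
exists ([set y : {ptws int -> bool} | y j = x j], [set n | (site_index j < n)%N]).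
  split => /=.
    have := @proj_continuous int (fun=> bool) j x [set x j].
    by apply; exact: discrete_set1.
  exact: nbhs_infty_gt.
by move=> [y n] /= [yj jn]; rewrite /truncation /proj jn yj.
Qed.

Lemma uniform_cylinder_approx (f : {ptws int -> bool} -> R) e :
  continuous f -> 0 < e ->
  exists s (g : config -> R), depends_on s g /\ forall x, `|f x - g x| <= e.
Proof.
move=> cf e0.
have := compact_configs => /compact_near_coveringP/(_ nat \oo
  (fun n x => `|f x - f (truncation n x)| <= e) _ _)/wrap[].
  move=> x _.
  have e2 : 0 < e / 2 by rewrite divr_gt0.
  have c1 : \forall y \near x, `|f x - f y| <= e / 2.
    by have /cvgrPdist_le/(_ _ e2) := cf x.
  have c2 : \forall p \near (x, \oo), `|f x - f (truncation p.2 p.1)| <= e / 2.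
    exact: (truncation_cvg c1).
  have c3 : \forall p \near ((x : {ptws int -> bool}), \oo), `|f x - f p.1| <= e / 2.
    exact: (cvg_fst c1).
  apply: filterS2 c2 c3 => -[y n] /= h1 h2.
  rewrite (_ : f y - f (truncation n y) =
    (f x - f (truncation n y)) - (f x - f y)); last by ring.
  by rewrite (le_trans (ler_normB _ _))// [leRHS](splitr e) lerD.
move=> [n _ /(_ n (leqnn n)) h].
exists [seq nth_site k | k <- iota 0 n], (f \o truncation n); split.
  move=> x y xy; congr f; apply/funext => j; rewrite /truncation.
  case: ifPn => // jn; rewrite -(site_indexK j); apply: xy.
  by apply: map_f; rewrite mem_iota.
by move=> x; exact: h.
Qed.

Lemma bounded_measurable_continuous (f : {ptws int -> bool} -> R) M :
  continuous f -> (forall x, `|f x| <= M) ->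
  bounded_measurable (f : config -> R).
Proof.
move=> cf fM; split; last by exists M.
have approx n : exists sg : seq int * (config -> R),
    depends_on sg.1 sg.2 /\ forall x, `|f x - sg.2 x| <= n.+1%:R^-1.
  have en : 0 < n.+1%:R^-1 :> R by rewrite invr_gt0.
  by have [s [g sg]] := uniform_cylinder_approx cf en; exists (s, g).
have [sg sgP] := choice approx.
apply: (@measurable_fun_cvg _ _ _ _ (fun n => (sg n).2)) => // [n|x _].
  by have [] := bounded_measurable_cylinder (sgP n).1.
apply/cvgrPdist_le => e e0.
have [n ne] : exists n : nat, e^-1 < n%:R by exists (Num.truncn e^-1).+1; exact: truncnS_gt.
exists n => // k /= nk; apply: le_trans ((sgP k).2 x) _.
rewrite -[e]invrK lef_pV2 ?posrE ?invr_gt0//.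
by rewrite (le_trans (ltW ne))// ler_nat leqW.
Qed.

End uniform_approximation.

(** * Ergodicity *)

Section comparison.
Context {R : realType}.

(** From [1 + x <= exp x]. *)
Lemma expR_decay (C bet e : R) : 0 <= C -> 0 < bet -> 0 < e ->
  exists2 T, 0 <= T & forall t, T <= t -> C * expR (- (bet * t)) <= e.
Proof.
move=> C0 b0 e0; exists (C / e / bet); first by rewrite !divr_ge0// ltW.
move=> t; rewrite ler_pdivrMr// ler_pdivrMr// => h.
rewrite expRN -ler_pdivlMr ?invr_gt0 ?expR_gt0// invrK.
apply: le_trans h _; rewrite mulrC ler_wpM2l//; first exact: ltW.
by rewrite mulrC; apply: le_trans (expR_ge1Dx _); rewrite lerDr.
Qed.

Lemma cvg_dist_le (u : nat -> R) (l x K : R) (N : nat) :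
  u n @[n --> \oo] --> l -> (forall n, (N <= n)%N -> `|x - u n| <= K) ->
  `|x - l| <= K.
Proof.
move=> ul h.
have c : `|x - u n| @[n --> \oo] --> `|x - l|.
  by apply: cvg_norm; apply: cvgB => //; exact: cvg_cst.
rewrite -(cvg_lim (@Rhausdorff R) c); apply: limr_le.
  by apply/cvg_ex; eexists; exact: c.
by exists N => // n /= /h.
Qed.

Variables (a b c m w : R).

Lemma solves_shift f s : 0 <= s -> solves_moment_equation a b c m f ->
  solves_moment_equation a b c m (fun t => f (s + t)).
Proof.
move=> s0 sf S; have [C C0 h] := sf S; exists C => // t e t0 e01.
by rewrite addrA; apply: h => //; rewrite addr_ge0.
Qed.

Lemma site_driftB (phi psi : {fset int} -> R) S j :
  site_drift a b c m (fun T => phi T - psi T) S j =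
  site_drift a b c m phi S j - site_drift a b c m psi S j.
Proof. by rewrite /site_drift; case: ifPn => _; ring. Qed.

Lemma solvesB f g : solves_moment_equation a b c m f ->
  solves_moment_equation a b c m g ->
  solves_moment_equation a b c m (fun t S => f t S - g t S).
Proof.
move=> sf sg S; have [C C0 hf] := sf S; have [D D0 hg] := sg S.
exists (C + D); first by rewrite addr_ge0.
move=> t e t0 e01; have h1 := hf t e t0 e01; have h2 := hg t e t0 e01.
under eq_bigr do rewrite site_driftB.
rewrite sumrB.
set A := \sum_(_ <- _) _ in h1 *; set B := \sum_(_ <- _) _ in h2 *.
rewrite (_ : _ - _ - _ = (f (t + e) S - f t S - e * A) -
  (g (t + e) S - g t S - e * B)); last by ring.
by rewrite mulrDl; apply: le_trans (ler_normB _ _) _; apply: lerD.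
Qed.

End comparison.

Lemma measurable_of_indic {R : realType} r (A : set config) :
  depends_on r (\1_A : config -> R) -> measurable A.
Proof.
move=> dA; have [+ _] := bounded_measurable_cylinder dA.
move=> /(_ measurableT [set 1] (measurable_set1 1)); rewrite setTI.
congr (measurable _); apply/seteqP; split => x /=; rewrite indicE.
  by case: (boolP (x \in _)) => [/set_mem//|_] /= /eqP; rewrite eq_sym oner_eq0.
by move=> xw; rewrite mem_set.
Qed.

Section ergodicity.
Context {R : realType} (P : bool -> bool -> bool -> R)
  (Pt : probability config R -> R -> probability config R).
Hypothesis hP : transition_matrix P.
Hypothesis hsym : P true true false = P true false true.
Hypothesis hPt : IPS_semigroup P Pt.
Variable m : R.
Hypothesis m01 : 0 <= m <= 1.
Let w := Num.max m (1 - m).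
Hypothesis contr : contracting (P true false false) (P true true false)
  (P true true true) m w.

Let bet := decay_rate (P true false false) (P true true false)
  (P true true true) m w.

Let bet0 : 0 < bet. Proof. exact: decay_rate_gt0. Qed.

Definition law_moment (nu : probability config R) (t : R) (S : {fset int}) : R :=
  mean (Pt nu t) (monomial m S).

Lemma law_moment_solves nu : solves_moment_equation (P true false false)
  (P true true false) (P true true true) m (law_moment nu).
Proof.
have [d [T [Pr [W [U [zeta [ips _ law]]]]]]] := hPt nu.
have E t : 0 <= t -> law_moment nu t = moment (Pr := Pr) zeta m t.
  move=> t0; apply/funext => S; apply: mean_comp.
  - exact: (IPS_measurable ips).
  - by move=> A mA; apply: law.
  - exact: bounded_measurable_monomial.
move=> S; have [C C0 h] := moment_one_step ips hP hsym m01 S.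
exists C => // t e t0 /andP[e0 e1]; rewrite !E ?addr_ge0//.
by apply: h => //; rewrite e0.
Qed.

Lemma law_moment_bound nu t S : `|law_moment nu t S| <= w ^+ #|` S|.
Proof.
apply: mean_norm_le; first exact: bounded_measurable_monomial.
by move=> x; exact: monomial_bound.
Qed.

Lemma law_initial nu f : bounded_measurable f -> mean (Pt nu 0) f = mean nu f.
Proof.
move=> bf; have [d [T [Pr [W [U [zeta [ips init law]]]]]]] := hPt nu.
have mz := IPS_measurable ips (lexx 0).
rewrite (mean_comp (mu := Pr) mz _ bf); last by move=> A mA; exact: law.
by rewrite (mean_comp (mu := Pr) mz _ bf)// => A mA; rewrite init.
Qed.

(** The difference of the two shifted families of moments satisfies the moment
equation and vanishes at the empty set. *)
Lemma law_moment_close nu nu' s s' K : 0 <= s -> 0 <= s' -> 0 <= K ->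
  (forall S, `|law_moment nu s S - law_moment nu' s' S| <= K * w ^+ #|` S|) ->
  forall t S, 0 <= t ->
  `|law_moment nu (s + t) S - law_moment nu' (s' + t) S| <=
    K * w ^+ #|` S| * expR (- (bet * t)).
Proof.
move=> s0 s'0 K0 hK t S t0.
pose g r T := law_moment nu (s + r) T - law_moment nu' (s' + r) T.
apply: (@moment_decay _ _ _ _ m w m01 erefl contr g 2 K) => //.
- by apply: solvesB; apply: solves_shift => //; exact: law_moment_solves.
- move=> r r0; rewrite /g /law_moment.
  have -> : monomial m fset0 = fun=> 1 by apply/funext => x; exact: monomial0.
  by rewrite !mean_cst subrr.
- move=> r T r0; rewrite /g; apply: le_trans (ler_normB _ _) _.
  by rewrite mulr2n mulrDl mul1r; apply: lerD; exact: law_moment_bound.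
- by move=> T; rewrite /g !addr0.
Qed.

Lemma law_moment_close2 nu nu' s s' t S : 0 <= s -> 0 <= s' -> 0 <= t ->
  `|law_moment nu (s + t) S - law_moment nu' (s' + t) S| <=
    2 * w ^+ #|` S| * expR (- (bet * t)).
Proof.
move=> s0 s'0 t0; apply: law_moment_close => // T.
apply: le_trans (ler_normB _ _) _.
by rewrite mulr2n mulrDl mul1r; apply: lerD; exact: law_moment_bound.
Qed.

Lemma cylinder_close r f M nu nu' s s' t : depends_on r f ->
  (forall x, `|f x| <= M) -> 0 <= s -> 0 <= s' -> 0 <= t ->
  `|mean (Pt nu (s + t)) f - mean (Pt nu' (s' + t)) f|
      <= 3 ^+ size r * M * 2 * expR (- (bet * t)).
Proof.
move=> df fM s0 s'0 t0; rewrite -mulrA.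
apply: (cylinder_seminorm (m := m) (N := fun f =>
  `|mean (Pt nu (s + t)) f - mean (Pt nu' (s' + t)) f|) _ _ m01 _ df fM).
- move=> h g q u dh dg.
  have bh := bounded_measurable_cylinder dh.
  have bg := bounded_measurable_cylinder dg.
  rewrite !meanD// opprD addrACA; exact: ler_normD.
- move=> q T; have bT := @bounded_measurable_monomial _ m T.
  rewrite !meanZ// -mulrBr normrM ler_wpM2l//.
  apply: le_trans (@law_moment_close2 nu nu' s s' t T s0 s'0 t0) _.
  rewrite ler_wpM2r ?expR_ge0// ler_piMr// exprn_ile1 ?(weight_le1 m01 erefl)//.
  by rewrite ltW// (weight_gt0 (m := m) erefl).
- by rewrite mulr_ge0 ?expR_ge0.
Qed.

Let nu0 : probability config R := dirac (point : config).

Lemma cylinder_cvg r f : depends_on r f -> cvgn (fun n => mean (Pt nu0 n%:R) f).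
Proof.
move=> df; have [_ [M fM]] := bounded_measurable_cylinder df.
have M0 : 0 <= M := le_trans (normr_ge0 _) (fM point).
have C0 : 0 <= 3 ^+ size r * M * 2 by rewrite !mulr_ge0// exprn_ge0.
apply/cauchy_cvgP/cauchy_exP => e e0.
have e2 : 0 < e / 2 by rewrite divr_gt0.
have [T T0 hT] := expR_decay C0 bet0 e2.
pose N := (Num.truncn T).+1.
exists (mean (Pt nu0 N%:R) f); exists N => // n /= Nn.
rewrite /ball/=; apply: le_lt_trans (_ : e / 2 < e); last first.
  by rewrite ltr_pdivrMr// ltr_pMr// ltr1n.
have := cylinder_close nu0 nu0 df fM (lexx 0) (ler0n _ (n - N)) (ler0n _ N).
rewrite add0r -natrD subnK// => /le_trans; apply; apply: hT.
exact/ltW/truncnS_gt.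
Qed.

Definition equilibrium : probability config R := limit_measure (fun n => Pt nu0 n%:R).

Lemma cylinder_equilibrium r f M nu t : depends_on r f ->
  (forall x, `|f x| <= M) -> 0 <= t ->
  `|mean (Pt nu t) f - mean equilibrium f|
    <= 3 ^+ size r * M * 2 * expR (- (bet * t)).
Proof.
move=> df fM t0.
apply: (@cvg_dist_le _ (fun n => mean (Pt nu0 n%:R) f) _ _ _ (Num.truncn t).+1).
  exact: (limit_measureP cylinder_cvg df).
move=> n nt.
have tn : t <= n%:R.
  by apply: le_trans (ltW (truncnS_gt t)) _; rewrite ler_nat.
have nt0 : 0 <= n%:R - t by rewrite subr_ge0.
have := cylinder_close nu nu0 df fM (lexx 0) nt0 t0.
by rewrite add0r subrK.
Qed.

(** The bound is uniform in [S] for the weighted norm, as [law_moment_close]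
requires for the proof of invariance. *)
Lemma moment_equilibrium nu t S : 0 <= t ->
  `|law_moment nu t S - mean equilibrium (monomial m S)| <=
    2 * w ^+ #|` S| * expR (- (bet * t)).
Proof.
move=> t0.
apply: (@cvg_dist_le _ (fun n => law_moment nu0 n%:R S) _ _ _ (Num.truncn t).+1).
  exact: (limit_measureP cylinder_cvg (@depends_on_monomial _ m S)).
move=> n nt.
have tn : t <= n%:R.
  by apply: le_trans (ltW (truncnS_gt t)) _; rewrite ler_nat.
have := @law_moment_close2 nu nu0 0 (n%:R - t) t S (lexx _) _ t0.
by rewrite add0r subrK; apply; rewrite subr_ge0.
Qed.

(** At a late time [T], the process started from [nu0] has almost the moments of
[equilibrium]. Running both for a further time [t], the first one still has
almost the moments of [equilibrium], and by [law_moment_close] so has the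
second one. *)
Lemma equilibrium_moment_stationary t S : 0 <= t ->
  law_moment equilibrium t S = mean equilibrium (monomial m S).
Proof.
move=> t0; apply/eqP; rewrite -subr_eq0 -normr_le0; apply/ler_addgt0Pr => e e0.
rewrite add0r.
have [T T0 hT] := expR_decay (ler0n R 4) bet0 e0.
have w0 : 0 <= w by rewrite ltW// (weight_gt0 (m := m) erefl).
have w1 k : w ^+ k <= 1 by rewrite exprn_ile1// (weight_le1 m01 erefl).
have wk k : 0 <= w ^+ k by rewrite exprn_ge0.
have eT : 0 <= expR (- (bet * T)) by rewrite expR_ge0.
have init S' : law_moment equilibrium 0 S' = mean equilibrium (monomial m S').
  by apply: law_initial; exact: bounded_measurable_monomial.
have h1 : `|law_moment nu0 (T + t) S - law_moment equilibrium (0 + t) S| <=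
    2 * expR (- (bet * T)) * w ^+ #|` S| * expR (- (bet * t)).
  apply: law_moment_close => //.
  move=> S'; rewrite init; apply: le_trans (moment_equilibrium nu0 S' T0) _.
  by rewrite mulrAC.
have h2 := moment_equilibrium nu0 S (addr_ge0 T0 t0).
apply: le_trans (hT T (lexx _)); rewrite add0r in h1.
rewrite (_ : law_moment equilibrium t S - mean equilibrium (monomial m S) =
 (law_moment nu0 (T + t) S - mean equilibrium (monomial m S)) -
 (law_moment nu0 (T + t) S - law_moment equilibrium t S)); last by ring.
apply: le_trans (ler_normB _ _) _.
rewrite (_ : 4 * expR (- (bet * T)) = 2 * expR (- (bet * T)) + 2 * expR (- (bet * T))); last by ring.
have et1 : expR (- (bet * t)) <= 1.
  by rewrite -expR0 ler_expR oppr_le0 mulr_ge0// ltW.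
have et0 : 0 <= expR (- (bet * t)) by exact: expR_ge0.
apply: lerD.
  apply: le_trans h2 _; rewrite mulrDr opprD expRD -mulrA ler_wpM2l//.
  by rewrite mulrCA ler_piMr// mulr_ile1.
apply: le_trans h1 _; rewrite -mulrA -[leRHS]mulr1 ler_wpM2l ?mulr_ge0//.
by rewrite mulr_ile1.
Qed.

(** Cylinder events form a pi-system that generates the sigma-algebra. *)
Lemma measure_cylinder_unique (m1 m2 : probability config R) :
  (forall r f, depends_on r f -> mean m1 f = mean m2 f) ->
  forall A, measurable A -> m1 A = m2 A.
Proof.
move=> eqm.
pose G := [set A : set config | exists r, depends_on r (\1_A : config -> R)].
have GG j b : G [set x : config | x j = b].
  exists [:: j] => x y xy; rewrite !indicE; congr (_%:R); congr nat_of_bool.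
  by apply/idP/idP; rewrite !inE /= (xy j) ?mem_head.
have mG A : G A -> measurable A by move=> [r]; exact: measurable_of_indic.
apply: (measure_unique G (fun=> setT)) => //.
- apply/seteqP; split.
    apply: smallest_sub; first exact: smallest_sigma_algebra.
    by move=> _ [j [b ->]]; apply: sub_gen_smallest; exact: GG.
  by apply: smallest_sub; [exact: sigma_algebra_measurable|exact: mG].
- move=> A B [r dA] [q dB]; exists (r ++ q) => x y xy; rewrite indicI /=.
  by congr (_ * _); [apply: dA|apply: dB] => j jr; apply: xy;
    rewrite mem_cat jr ?orbT.
- by move=> _; exists [::] => x y _; rewrite !indicE !mem_set.
- by rewrite bigcup_const//; exists 0%N.
- move=> A GA; have [r dA] := GA; have := eqm r _ dA.
  rewrite !mean_indic; [|exact: mG|exact: mG].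
  move=> E; rewrite -[LHS]fineK ?fin_num_measure//; last exact: mG.
  by rewrite -[RHS]fineK ?fin_num_measure//; [congr EFin|exact: mG].
- by move=> _; apply: le_lt_trans (ltry 1); exact: (@probability_le1 _ _ _ m1).
Qed.

Lemma equilibrium_invariant : invariant_distribution Pt equilibrium.
Proof.
move=> t t0; apply: measure_cylinder_unique => r f df.
have [_ [M fM]] := bounded_measurable_cylinder df.
apply/eqP; rewrite -subr_eq0 -normr_le0 -(mulr0 (3 ^+ size r * M)).
apply: (cylinder_seminorm (m := m) (N := fun f =>
  `|mean (Pt equilibrium t) f - mean equilibrium f|) _ _ m01 _ df fM) => //.
- move=> h g q u dh dg.
  have bh := bounded_measurable_cylinder dh.
  have bg := bounded_measurable_cylinder dg.
  rewrite !meanD// opprD addrACA; exact: ler_normD.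
- move=> q T; have bT := @bounded_measurable_monomial _ m T.
  rewrite !meanZ// -mulrBr normrM ler_wpM2l// normr_le0 subr_eq0.
  by apply/eqP; exact: equilibrium_moment_stationary.
Qed.

Lemma equilibrium_attractive : attractive_distribution Pt equilibrium.
Proof.
move=> nu f cf [M fM].
have bf := bounded_measurable_continuous cf fM.
have fE (mu : probability config R) :
    (\int[mu]_(x in [set: config]) (f x)%:E)%E = (mean mu f)%:E.
  rewrite /mean /Rintegral fineK//.
  have := bounded_measurable_integrable mu bf.
  exact: integrable_fin_num.
rewrite fE; under eq_fun do rewrite fE.
apply: cvg_EFin; first by apply: nearW.
apply/cvgrPdist_le => e e0.
have e3 : 0 < e / 3 by rewrite divr_gt0.
have [r [g [dg fg]]] := uniform_cylinder_approx cf e3.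
have [_ [N gN]] := bounded_measurable_cylinder dg.
have N0 : 0 <= N := le_trans (normr_ge0 _) (gN point).
have C0 : 0 <= 3 ^+ size r * N * 2 by rewrite !mulr_ge0// exprn_ge0.
have [T T0 hT] := expR_decay C0 bet0 e3.
have bg := bounded_measurable_cylinder dg.
have near_fg (mu : probability config R) : `|mean mu f - mean mu g| <= e / 3.
  rewrite -meanB//; apply: mean_norm_le => //; exact: bounded_measurableB.
exists T; split; first exact: num_real.
move=> t Tt /=.
have t0 : 0 <= t by rewrite (le_trans T0)// ltW.
have h1 := near_fg equilibrium; have h2 := near_fg (Pt nu t).
have h3 := le_trans (cylinder_equilibrium nu dg gN t0) (hT t (ltW Tt)).
rewrite (_ : mean equilibrium f - mean (Pt nu t) f =
  (mean equilibrium f - mean equilibrium g) -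
  (mean (Pt nu t) g - mean equilibrium g) -
  (mean (Pt nu t) f - mean (Pt nu t) g)); last by ring.
rewrite (_ : e = e / 3 + e / 3 + e / 3); last by field.
apply: le_trans (ler_normB _ _) _; apply: lerD => //.
by apply: le_trans (ler_normB _ _) _; apply: lerD.
Qed.

Lemma equilibrium_exponential (S : set int) : finite_set S ->
  exists2 C : R, 0 <= C &
    forall (t : R) (A : set config), 0 <= t -> cylinder_with_support S A ->
      (ereal_sup [set `|Pt nu t A - equilibrium A| | nu in setT]
         <= (C * expR (- (bet * t)))%:E)%E.
Proof.
move=> /finite_seqP[r ->]; exists (3 ^+ size r * 1 * 2).
  by rewrite !mulr_ge0// exprn_ge0.
move=> t A t0 cA.
have dA : depends_on r (\1_A : config -> R).
  move=> x y xy; rewrite !indicE; congr (_%:R); congr nat_of_bool.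
  by apply/idP/idP; rewrite !inE; apply: cA => // j /= jr; rewrite xy.
have mA := measurable_of_indic dA.
apply: ge_ereal_sup => _ [nu _ <-].
have A1 x : `|\1_A x : R| <= 1 by rewrite indicE normr_nat lern1 leq_b1.
have := cylinder_equilibrium nu dA A1 t0.
rewrite !mean_indic// => h.
have f1 : Pt nu t A \is a fin_num by rewrite fin_num_measure.
have f2 : equilibrium A \is a fin_num by rewrite fin_num_measure.
by rewrite -(fineK f1) -(fineK f2) -EFinB abse_EFin lee_fin.
Qed.

End ergodicity.

Theorem corollary7p1 (R : realType) (P : bool -> bool -> bool -> R)
  (Pt : probability config R -> R -> probability config R)
  (hP : transition_matrix P)
  (h11 : P true true true < 1) (h10 : P true true false < 1)
  (h01 : 0 < P true false true) (h00 : 0 < P true false false)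
  (hsym : P true true false = P true false true)
  (hPt : IPS_semigroup P Pt) :
  uniformly_exponentially_ergodic Pt.
Proof.
have /andP[_ a1] := transition_01 hP false false.
have /andP[c0 _] := transition_01 hP true true.
have b0 : 0 < P true true false by rewrite hsym.
have [m m01 contr] := contracting_parameters h00 a1 b0 h10 c0 h11.
exists (equilibrium Pt); split.
- exact: (equilibrium_invariant hP hsym hPt m01 contr).
- exact: (equilibrium_attractive hP hsym hPt m01 contr).
- exists (decay_rate (P true false false) (P true true false)
    (P true true true) m (Num.max m (1 - m))).
    exact: decay_rate_gt0.
  exact: (equilibrium_exponential hP hsym hPt m01 contr).
Qed.
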